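(* Let $\mathbf{k}\subset\mathbf{n}$ with $|\mathbf{k}|\ge2$ and let $q(t)$ be a $\mathbf{k}$-parabolic solution of the planar $n$-body problem. Then, as $t\to\infty$: (a) $|h_{\mathbf{k}}(t)|=O(t^{-5/3})$; (b) the normalized relative configuration $\hat q^c_{\mathbf{k}}(t)$ approaches the set $\hat{\mathscr{C}}_{\mathbf{k}}$ (i.e. its distance to $\hat{\mathscr{C}}_{\mathbf{k}}$ tends to $0$).
   Context: Planar $n$-body problem: $\mathbf{n}=\{1,\dots,n\}$, masses $m_i>0$, positions $q_i\in\mathbb{R}^2$, $r_{ij}=|q_i-q_j|$, $U(q)=\sum_{i<j}\frac{m_im_j}{r_{ij}}$, and the equations of motion are $m_i\ddot q_i=\nabla_iU(q)$ for all $i\in\mathbf{n}$. The center of mass is fixed at the origin: $q\in\mathbb{E}=\{q\in\mathbb{R}^{2n}:\sum_{i\in\mathbf{n}}m_iq_i=0\}$. $\mathbf{k}$-parabolic: for $\mathbf{k}\subset\mathbf{n}$ with $|\mathbf{k}|\ge2$ and $\mathbf{k}'=\mathbf{n}\setminus\mathbf{k}$, a solution $q:(t_0,\infty)\to\mathbb{E}$ is $\mathbf{k}$-parabolic if there exist constants $C_1,C_2,C_3>0$ such that, as $t\to\infty$ (i.e. for all large $t$), $C_1t^{2/3}\le r_{ij}(t)\le C_2t^{2/3}$ for all $i\ne j\in\mathbf{k}$, and $r_{ij}(t)\ge C_3t$ for all $i\in\mathbf{k}$, $j\in\mathbf{k}'$. (No assumption is made that $\max_{i\neq j} r_{ij}(t)=O(t)$.)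 Notation for the $\mathbf{k}$-subsystem: $m_{\mathbf{k}}=\sum_{i\in\mathbf{k}}m_i$, $c_{\mathbf{k}}=m_{\mathbf{k}}^{-1}\sum_{i\in\mathbf{k}}m_iq_i$, $\mathbb{E}_{\mathbf{k}}=\{(q_i)_{i\in\mathbf{k}}\in\mathbb{R}^{2|\mathbf{k}|}:\sum_{i\in\mathbf{k}}m_iq_i=0\}$, $q^c_{\mathbf{k}}=(q_i-c_{\mathbf{k}})_{i\in\mathbf{k}}$, $I_{\mathbf{k}}(q^c_{\mathbf{k}})=\sum_{i\in\mathbf{k}}m_i|q_i-c_{\mathbf{k}}|^2$, $\hat q^c_{\mathbf{k}}=q^c_{\mathbf{k}}/\sqrt{I_{\mathbf{k}}(q^c_{\mathbf{k}})}$, which lies in $S_{\mathbf{k}}=\{q_{\mathbf{k}}=(q_i)_{i\in\mathbf{k}}\in\mathbb{E}_{\mathbf{k}}:\sum_{i\in\mathbf{k}}m_i|q_i|^2=1\}$, and $U_{\mathbf{k}}=\sum_{i,j\in\mathbf{k},\,i<j}\frac{m_im_j}{r_{ij}}$. The energy of the $\mathbf{k}$-subsystem is $$h_{\mathbf{k}}=\sum_{i\in\mathbf{k}}\frac{m_i}{2}|\dot q_i-\dot c_{\mathbf{k}}|^2-\sum_{i,j\in\mathbf{k},\,i<j}\frac{m_im_j}{r_{ij}}.$$ A central configuration (CC) of the $\mathbf{k}$-subsystem is $q_{\mathbf{k}}\in\mathbb{E}_{\mathbf{k}}$ for which there is $\lambda>0$ with $\nabla_iU_{\mathbf{k}}(q_{\mathbf{k}})+\lambda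 m_iq_i=0$ for all $i\in\mathbf{k}$; $\mathscr{C}_{\mathbf{k}}$ is the set of all CCs and $\hat{\mathscr{C}}_{\mathbf{k}}=\mathscr{C}_{\mathbf{k}}\cap S_{\mathbf{k}}$ the set of normalized CCs. *)

(* Defs.v *)
From HB Require Import structures.
From mathcomp Require Import all_boot all_order all_algebra.
From mathcomp Require Import all_classical all_reals all_analysis.

Set Implicit Arguments.
Unset Strict Implicit.
Unset Printing Implicit Defensive.

Import Order.TTheory GRing.Theory Num.Theory.
Import numFieldNormedType.Exports.

Local Open Scope classical_set_scope.
Local Open Scope ring_scope.

(* Needed to form [f =O_ (pinfty_nbhs R) g]. *)
Canonical pinfty_nbhs_filter_on (R : numFieldType) :=
  FilterType (pinfty_nbhs R) _.

(* A configuration of N planar bodies is q : 'M[R]_(N, 2); row i q is the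
   position of body i.  Everything is stated for an arbitrary system of N bodies
   with masses mu, so that it applies both to the full n-body system and to the
   k-subsystem, whose bodies are numbered by 'I_#|k| through enum_val. *)

(* The library norm of a matrix is the max norm; this is the Euclidean one. *)
Definition enorm (R : realType) (p r : nat) (v : 'M[R]_(p, r)) : R :=
  Num.sqrt (\sum_i \sum_j v i j ^+ 2).

Definition edistance_to (R : realType) (p r : nat) (A : set 'M[R]_(p, r))
    (x : 'M[R]_(p, r)) : \bar R :=
  ereal_inf [set (enorm (x - y))%:E | y in A].

Section Bodies.
Variables (R : realType) (N : nat) (mu : 'I_N -> R).
Implicit Types (q : 'M[R]_(N, 2)) (x : R -> 'M[R]_(N, 2)) (i j : 'I_N).

Definition rdist q i j : R := enorm (row i q - row j q).

(* Since 0^-1 = 0, the potential is meaningful only at such configurations. *)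
Definition collision_free q : Prop := forall i j, i != j -> rdist q i j != 0.

Definition potential q : R :=
  \sum_(i < N) \sum_(j < N | (i < j)%N) mu i * mu j / rdist q i j.

Definition grad_potential q i : 'rV[R]_2 :=
  \row_(a < 2) 'D_(delta_mx i a) potential q.

Definition centered q : Prop := \sum_i mu i *: row i q = 0.

Definition barycenter q : 'rV[R]_2 :=
  (\sum_i mu i)^-1 *: \sum_i mu i *: row i q.

Definition relative q : 'M[R]_(N, 2) := \matrix_i (row i q - barycenter q).

Definition inertia q : R := \sum_i mu i * enorm (row i q) ^+ 2.

Definition normalized q : 'M[R]_(N, 2) :=
  (Num.sqrt (inertia (relative q)))^-1 *: relative q.

Definition energy x (t : R) : R :=
  (\sum_i mu i / 2 *
     enorm (row i (x^`()%classic t) - (barycenter \o x)^`()%classic t) ^+ 2)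
  - potential (x t).

Definition central_configurations : set 'M[R]_(N, 2) :=
  [set q | [/\ centered q, collision_free q & exists2 lambda : R, 0 < lambda &
    forall i, grad_potential q i + (lambda * mu i) *: row i q = 0]].

Definition unit_sphere : set 'M[R]_(N, 2) :=
  [set q | centered q /\ inertia q = 1].

Definition normalized_ccs : set 'M[R]_(N, 2) :=
  central_configurations `&` unit_sphere.

(* x is a centered solution on ]t0, +oo[; its values elsewhere are irrelevant. *)
Definition nbody_solution (t0 : R) x : Prop := forall t : R, t0 < t ->
  [/\ centered (x t), collision_free (x t),
      derivable x t 1, derivable x^`()%classic t 1 &
      forall i, mu i *: row i (x^`(2)%classic t) = grad_potential (x t) i].

End Bodies.

Section Subsystem.
Variables (R : realType) (n : nat) (k : {set 'I_n}).

Definition submass (m : 'I_n -> R) : 'I_#|k| -> R := fun i => m (enum_val i).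

Definition subconf (q : 'M[R]_(n, 2)) : 'M[R]_(#|k|, 2) :=
  rowsub (fun i : 'I_#|k| => enum_val i) q.

Definition parabolic (m : 'I_n -> R) (t0 : R) (q : R -> 'M[R]_(n, 2)) : Prop :=
  nbody_solution m t0 q /\
  exists C1 C2 C3 : R, [/\ 0 < C1, 0 < C2, 0 < C3 &
    \forall t \near pinfty_nbhs R,
      (forall i j, i \in k -> j \in k -> i != j ->
         C1 * t `^ (2 / 3) <= rdist (q t) i j <= C2 * t `^ (2 / 3)) /\
      (forall i j, i \in k -> j \notin k -> C3 * t <= rdist (q t) i j)].

End Subsystem.

Arguments submass {R n} k m.
Arguments subconf {R n} k q.
Arguments parabolic {R n} k m t0 q.

(* Main.v *)
Require Import Defs.
From HB Require Import structures.
From mathcomp Require Import all_boot all_order all_algebra.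
From mathcomp Require Import all_classical all_reals all_analysis.
From mathcomp Require Import ring lra zify.

(** Put s = t^(1/3).  Along a parabolic solution the bodies of the subsystem k
    are at mutual distances of exact order s^2, and the other bodies are at
    distance at least of order s^3 from them.  Relative to its barycenter, the
    subsystem is therefore an autonomous N-body system perturbed by a tidal
    acceleration: the differences of the external attractions on two bodies of
    k, of size s^2 / (s^3)^3 = s^-7 ([tidal_bound], [external_growth]).

    Energy.  The energy h of the subsystem changes only through the power of
    the tidal acceleration.  A Gronwall argument bounds the velocities
    ([velocity_bounded]), so h' = O(s^-7) is integrable and h has a limit.
    The limit is not negative because kinetic energy is nonnegative and the
    potential vanishes at infinity; it is not positive because the Lagrange-
    Jacobi identity would then make the virial <X, V> grow linearly in t, which
    is excluded by X = O(s^2), V = O(1) ([energy_cvg0]).  Hence h = O(s^-4),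
    the kinetic energy is O(s^-2) like the potential, V = O(s^-1), and
    h' = O(s^-8) integrates to h = O(s^-5) = O(t^(-5/3)) ([energy_growth]).

    Configuration.  In the blow-up Z = s^-2 X and logarithmic time, with
    W = t Z', the equations become
      t W' + W / 3 = (2 / 9) Z + (acceleration at Z) + o(1):
    an autonomous system with friction.  The scaled energy
      |W|^2 / 2 - U(Z) - |Z|^2 / 9
    decreases at rate |W|^2 / 3 up to an integrable error and is bounded, so it
    converges.  Barbalat's lemma ([barbalat]), in the form suited to
    logarithmic time, gives W -> 0 ([drift_cvg0]); applied once more to W
    itself it gives (2 / 9) Z + (acceleration at Z) -> 0 ([defect_cvg0]).
    This is the central configuration equation in the limit.  Since Z stays in
    a compact set of collision-free configurations, its cluster points are
    central configurations, and the distance of the normalized configuration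
    to the normalized central configurations tends to 0
    ([approach_normalized_ccs]). *)

Set Implicit Arguments.
Unset Strict Implicit.
Unset Printing Implicit Defensive.

Import Order.TTheory GRing.Theory Num.Theory.
Import numFieldNormedType.Exports.

Local Open Scope classical_set_scope.
Local Open Scope ring_scope.

(** * Powers of the cube root of time as a growth scale *)

Section Growth.
Variable R : realType.
Implicit Types (f g F : R -> R) (p q : int) (t : R).

Definition cbrt t : R := t `^ 3^-1.

(** All exponents of t in the argument are multiples of 1/3; counting powers of
    the cube root keeps them integral, so that exponents add by computation. *)
Definition growth p g : Prop :=
  exists C : R, \forall t \near +oo, `|g t| <= C * cbrt t ^ p.

Lemma cbrt_gt0 t : 0 < t -> 0 < cbrt t.
Proof. exact: powR_gt0. Qed.

Lemma cbrtK t : 0 <= t -> cbrt t ^+ 3 = t.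
Proof.
by move=> t0; rewrite /cbrt -powR_mulrn ?powR_ge0// -powRrM mulVf// powRr1.
Qed.

Lemma cbrt_ge1 t : 1 <= t -> 1 <= cbrt t.
Proof. by move=> t1; rewrite -(powRr0 t) ler_powR. Qed.

Lemma near_cbrt_ge1 : \forall t \near +oo, 1 <= cbrt t.
Proof. by near=> t; apply: cbrt_ge1. Unshelve. all: by end_near. Qed.

Lemma near_cbrt_gt0 : \forall t \near +oo, 0 < cbrt t.
Proof. by near=> t; apply: cbrt_gt0. Unshelve. all: by end_near. Qed.

Lemma growth_ge0 p g : growth p g ->
  exists2 C : R, 0 < C & \forall t \near +oo, `|g t| <= C * cbrt t ^ p.
Proof.
case=> C HC; exists (`|C| + 1) => //; near=> t.
have s0 : 0 < cbrt t by near: t; exact: near_cbrt_gt0.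
apply: (@le_trans _ _ (C * cbrt t ^ p)); first by near: t.
rewrite ler_wpM2r ?exprz_ge0 ?ltW//.
by rewrite (le_lt_trans (ler_norm C))// ltrDl.
Unshelve. all: by end_near. Qed.

Lemma growth_near p f g : (\forall t \near +oo, f t = g t) ->
  growth p f -> growth p g.
Proof.
move=> fg [C HC]; exists C; near=> t.
have <- : f t = g t by near: t.
by near: t.
Unshelve. all: by end_near. Qed.

Lemma growth_le_near p f g : (\forall t \near +oo, `|g t| <= `|f t|) ->
  growth p f -> growth p g.
Proof.
move=> fg [C HC]; exists C; near=> t.
apply: (@le_trans _ _ `|f t|); by near: t.
Unshelve. all: by end_near. Qed.

Lemma growth_weaken p q g : p <= q -> growth p g -> growth q g.
Proof.
move=> pq /growth_ge0[C C0 HC]; exists C; near=> t.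
apply: (@le_trans _ _ (C * cbrt t ^ p)); first by near: t.
have s1 : 1 <= cbrt t by near: t; exact: near_cbrt_ge1.
by rewrite ler_pM2l// ler_weXz2l.
Unshelve. all: by end_near. Qed.

Lemma growthD p f g : growth p f -> growth p g ->
  growth p (fun t => f t + g t).
Proof.
move=> [C HC] [D HD]; exists (C + D); near=> t.
rewrite mulrDl (le_trans (ler_normD _ _))// lerD//; by near: t.
Unshelve. all: by end_near. Qed.

Lemma growthN p f : growth p f -> growth p (fun t => - f t).
Proof. by move=> [C HC]; exists C; near=> t; rewrite normrN; near: t.
Unshelve. all: by end_near. Qed.

Lemma growthB p f g : growth p f -> growth p g ->
  growth p (fun t => f t - g t).
Proof. by move=> Hf /growthN; exact: growthD. Qed.

Lemma growthM p q r f g : p + q = r -> growth p f -> growth q g ->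
  growth r (fun t => f t * g t).
Proof.
move=> <- [C HC] [D HD]; exists (C * D); near=> t.
have s0 : 0 < cbrt t by near: t; exact: near_cbrt_gt0.
rewrite expfzDr ?gt_eqF// mulrACA normrM ler_pM//; by near: t.
Unshelve. all: by end_near. Qed.

Lemma growth_cst c : growth 0 (fun=> c).
Proof. by exists `|c|; near=> t; rewrite expr0z mulr1.
Unshelve. all: by end_near. Qed.

Lemma growthZ p c f : growth p f -> growth p (fun t => c * f t).
Proof. by apply: growthM (growth_cst c); rewrite add0r. Qed.

Lemma growth_sum (I : Type) (r : seq I) (P : pred I) p (f : I -> R -> R) :
  (forall i, P i -> growth p (f i)) ->
  growth p (fun t => \sum_(i <- r | P i) f i t).
Proof.
move=> H; elim: r => [|i r IH].
  by exists 0; near=> t; rewrite (big_nil _ _ P (fun i => f i t)) normr0 mul0r.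
have -> : (fun t => \sum_(i0 <- i :: r | P i0) f i0 t) = (fun t =>
    if P i then f i t + \sum_(i <- r | P i) f i t
    else \sum_(i <- r | P i) f i t).
  by apply/funext => t; rewrite big_cons.
by case Pi: (P i) => //; exact: growthD (H _ Pi) IH.
Unshelve. all: by end_near. Qed.

Lemma growth_cbrt p : growth p (fun t => cbrt t ^ p).
Proof.
exists 1; near=> t; rewrite mul1r ger0_norm// exprz_ge0// ltW//.
by near: t; exact: near_cbrt_gt0.
Unshelve. all: by end_near. Qed.

(** Turns a bound on kinetic energy into a bound on each velocity component. *)
Lemma growth_sqr p g : growth (p + p) (fun t => g t ^+ 2) -> growth p g.
Proof.
move=> /growth_ge0[C C0 HC]; exists (C + 1); near=> t.
have s0 : 0 < cbrt t by near: t; exact: near_cbrt_gt0.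
have C1 : 0 <= C + 1 by lra.
rewrite -ler_sqr ?nnegrE ?normr_ge0 ?mulr_ge0 ?exprz_ge0 ?(ltW s0)// -normrX.
apply: (@le_trans _ _ (C * cbrt t ^ (p + p))); first by near: t.
rewrite expfzDr ?gt_eqF// exprMn -expr2 ler_pM2r ?exprn_gt0 ?exprz_gt0//; nra.
Unshelve. all: by end_near. Qed.

Lemma cbrtXE p t : cbrt t ^ p = t `^ (p%:~R / 3).
Proof. by rewrite -powR_intmul ?powR_ge0// -powRrM mulrC. Qed.

Lemma is_derive_cbrtX p t : 0 < t ->
  is_derive t 1 (fun s => cbrt s ^ p) (p%:~R / 3 * cbrt t ^ (p - 3)).
Proof.
move=> t0; rewrite (_ : (fun s => cbrt s ^ p) = (@powR R) ^~ (p%:~R / 3)); last first.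
  by apply/funext => s; rewrite cbrtXE.
apply: is_derive_eq; first exact: is_derive1_powR.
by rewrite cbrtXE rmorphB/=; congr (_ * _ `^ _); field.
Qed.

Lemma growth_cvg0 p g : p < 0 -> growth p g -> g t @[t --> +oo] --> 0.
Proof.
move=> p0 /growth_ge0[C C0 HC].
apply/cvgr0Pnorm_le => e e0; near=> t.
have s1 : 1 <= cbrt t by near: t; exact: near_cbrt_ge1.
apply: (@le_trans _ _ (C * cbrt t ^ p)); first by near: t.
apply: (@le_trans _ _ (C * cbrt t ^ (-1))).
  by rewrite ler_pM2l// ler_weXz2l// -ltzD1 subrr.
have Ce : 0 <= C / e by rewrite divr_ge0// ltW.
have s0 : 0 < cbrt t by exact: lt_le_trans ltr01 s1.
rewrite exprN1 ler_pdivrMr// -ler_pdivrMl// mulrC.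
by rewrite -(@ler_pXn2r _ 3) ?nnegrE ?(ltW s0)// cbrtK//.
Unshelve. all: by end_near. Qed.

(** Derivative rules for lambda terms, with values written with the ring product
    instead of scaling: explicit formulas in t are differentiated by composing
    these proofs, and the result is left to field. *)
Lemma is_derive1D f g t df dg : is_derive t 1 f df -> is_derive t 1 g dg ->
  is_derive t 1 (fun s => f s + g s) (df + dg).
Proof. exact: is_deriveD. Qed.

Lemma is_derive1B f g t df dg : is_derive t 1 f df -> is_derive t 1 g dg ->
  is_derive t 1 (fun s => f s - g s) (df - dg).
Proof. exact: is_deriveB. Qed.

Lemma is_derive1M f g t df dg : is_derive t 1 f df -> is_derive t 1 g dg ->
  is_derive t 1 (fun s => f s * g s) (df * g t + f t * dg).
Proof.
move=> Hf Hg; apply: (is_derive_eq (is_deriveM Hf Hg)).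
by rewrite /GRing.scale/= addrC mulrC.
Qed.

Lemma is_derive1cM c f t df : is_derive t 1 f df ->
  is_derive t 1 (fun s => c * f s) (c * df).
Proof. exact: is_deriveZ. Qed.

Lemma is_derive1sqr f t df : is_derive t 1 f df ->
  is_derive t 1 (fun s => f s ^+ 2) (2 * f t * df).
Proof.
by move=> Hf; apply: (is_derive_eq (is_derive1M Hf Hf)); ring.
Qed.

Lemma is_derive1_sum (I : Type) (r : seq I) (P : pred I) (f : I -> R -> R) t
    (df : I -> R) :
  (forall i, P i -> is_derive t 1 (f i) (df i)) ->
  is_derive t 1 (fun s => \sum_(i <- r | P i) f i s) (\sum_(i <- r | P i) df i).
Proof.
move=> H; elim: r => [|i r IH].
  have -> : (fun s => \sum_(i <- [::] | P i) f i s) = cst 0.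
    by apply/funext => s; rewrite big_nil.
  by rewrite big_nil; exact: is_derive_cst.
have -> : (fun t => \sum_(i0 <- i :: r | P i0) f i0 t) = (fun t =>
    if P i then f i t + \sum_(i <- r | P i) f i t
    else \sum_(i <- r | P i) f i t).
  by apply/funext => s; rewrite big_cons.
by rewrite big_cons; case Pi: (P i) => //; exact: is_derive1D (H _ Pi) IH.
Qed.

End Growth.

(** * Convergence from differential inequalities *)

Section Convergence.
Variable R : realType.
Implicit Types (e f g F : R -> R) (p q : int) (t : R).

Lemma mean_value F F' (M s t : R) :
  (forall x, M < x -> is_derive x 1 F (F' x)) -> M < s -> s <= t ->
  exists2 c, s <= c <= t & F t - F s = F' c * (t - s).
Proof.
move=> dF Ms st; have [||c] := @MVT_segment _ F F' s t st.
- by move=> x; rewrite in_itv/= => /andP[sx _]; apply/dF/(lt_trans Ms).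
- apply: derivable_within_continuous => x; rewrite in_itv/= => /andP[sx _].
  by have [] := dF x (lt_le_trans Ms sx).
- by rewrite in_itv/= => cst ->; exists c.
Qed.

Lemma nonincreasing_cvg F (M B : R) :
  (forall s t, M < s -> s <= t -> F t <= F s) -> (forall t, M < t -> B <= F t) ->
  exists2 L, F t @[t --> +oo] --> L & forall t, M < t -> L <= F t.
Proof.
move=> Fn FB; pose A := [set F t | t in [set t | M < t]].
have A0 : A !=set0 by exists (F (M + 1)); exists (M + 1) => //=; rewrite ltrDl.
have lA : has_lbound A by exists B => _ [t /= Mt <-]; exact: FB.
have LF t : M < t -> inf A <= F t by move=> Mt; apply: ge_inf => //; exists t.
exists (inf A) => //; apply/cvgrPdist_le => e e0.
have [_ [s /= Ms <-] Fs] := inf_adherent e0 (conj A0 lA).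
near=> t.
have Mt : M < t by near: t; apply: nbhs_pinfty_gt; exact: num_real.
have st : s <= t by near: t; apply: nbhs_pinfty_ge; exact: num_real.
rewrite distrC ger0_norm ?subr_ge0 ?LF// lerBlDl.
by rewrite (le_trans (Fn _ _ Ms st))// ltW.
Unshelve. all: by end_near. Qed.

(** The derivative of a multiple of t^(p/3 + 1) absorbs the positive part of
    the derivative of F; the condition p < -3 makes that correction decay. *)
Lemma quasi_nonincreasing F f (C : R) p : p < - 3%:Z -> 0 <= C ->
  (\forall t \near +oo, is_derive (t : R) 1 F (f t)) ->
  (\forall t \near +oo, f t <= C * cbrt t ^ p) ->
  exists C' M, [/\ 0 <= C', 0 <= M & forall s t, M < s -> s <= t ->
    F t + C' * cbrt t ^ (p + 3) <= F s + C' * cbrt s ^ (p + 3)].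
Proof.
move=> p3 C0 dF fC.
have d0 : (p + 3)%:~R / 3 < 0 :> R.
  rewrite pmulr_llt0 ?invr_gt0// ltrz0; move: p3; lia.
pose C' := - (C / ((p + 3)%:~R / 3)).
have C'0 : 0 <= C' by rewrite /C' oppr_ge0 mulr_ge0_le0// invr_le0 ltW.
pose G t := F t + C' * cbrt t ^ (p + 3).
have [M [Mr HM]] : \forall t \near +oo,
    is_derive (t : R) 1 F (f t) /\ f t <= C * cbrt t ^ p.
  by near=> t; split; near: t.
have dG t : Num.max M 0 < t -> is_derive t 1 G (f t - C * cbrt t ^ p).
  rewrite gt_max => /andP[Mt t0]; have [dFt _] := HM t Mt.
  apply: (is_derive_eq (is_derive1D dFt (is_derive1cM C' (is_derive_cbrtX _ t0)))).
  by rewrite addrK /C' mulrA mulNr divfK ?mulNr// lt_eqF.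
exists C', (Num.max M 0); split=> //; first by rewrite le_max lexx orbT.
move=> s t Ms st; have [c /andP[sc ct] E] := mean_value dG Ms st.
rewrite -subr_le0 E mulr_le0_ge0 ?subr_ge0// subr_le0.
apply: (HM c _).2; apply: lt_le_trans sc.
by move: Ms; rewrite gt_max => /andP[].
Unshelve. all: by end_near. Qed.

Lemma quasi_nonincreasing_cvg F f (C : R) p (B : R) : p < - 3%:Z -> 0 <= C ->
  (\forall t \near +oo, is_derive (t : R) 1 F (f t)) ->
  (\forall t \near +oo, f t <= C * cbrt t ^ p) ->
  (\forall t \near +oo, B <= F t) ->
  exists2 L, F t @[t --> +oo] --> L & exists C', \forall t \near +oo,
    L - F t <= C' * cbrt t ^ (p + 3).
Proof.
move=> p3 C0 dF fC FB.
have [C' [M [C'0 M0 HM]]] := quasi_nonincreasing p3 C0 dF fC.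
have [N [Nr HN]] := FB.
pose G t := F t + C' * cbrt t ^ (p + 3).
have [||L GL LG] := @nonincreasing_cvg G (Num.max M N) B.
- by move=> s t; rewrite gt_max => /andP[Ms _]; exact: HM.
- move=> t; rewrite gt_max => /andP[Mt Nt].
  rewrite (le_trans (HN t Nt))// lerDl mulr_ge0// exprz_ge0// ltW// cbrt_gt0//.
  exact: le_lt_trans Mt.
exists L; last first.
  exists C'; near=> t; rewrite lerBlDl; apply: LG.
  by near: t; apply: nbhs_pinfty_gt; exact: num_real.
have c0 : growth (p + 3) (fun t => C' * cbrt t ^ (p + 3)).
  exact/growthZ/growth_cbrt.
rewrite (_ : F = fun t => G t - C' * cbrt t ^ (p + 3)).
  rewrite -[X in _ --> X]subr0; apply: cvgB => //; apply: growth_cvg0 c0.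
  by move: p3; lia.
by apply/funext => t; rewrite /G addrK.
Unshelve. all: by end_near. Qed.

(** Both F and its opposite are nonincreasing up to a decaying correction:
    each bounds the other from below, and the corrections bound the rate of
    convergence. *)
Lemma growth_primitive F f p : p < - 3%:Z ->
  (\forall t \near +oo, is_derive (t : R) 1 F (f t)) -> growth p f ->
  exists2 L, F t @[t --> +oo] --> L & growth (p + 3) (fun t => F t - L).
Proof.
move=> p3 dF /growth_ge0[C /ltW C0 fC].
have dNF : \forall t \near +oo, is_derive (t : R) 1 (fun t => - F t) (- f t).
  by near=> t; apply: is_deriveN; near: t.
have fC1 : \forall t \near +oo, f t <= C * cbrt t ^ p.
  by near=> t; rewrite (le_trans (ler_norm _))//; near: t.
have fC2 : \forall t \near +oo, - f t <= C * cbrt t ^ p.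
  by near=> t; rewrite (le_trans (ler_norm _))// normrN; near: t.
(* quasi-monotonicity of the opposite function bounds a function from below *)
have lb (h h' : R -> R) : (\forall t \near +oo, is_derive (t : R) 1 h (h' t)) ->
    (\forall t \near +oo, h' t <= C * cbrt t ^ p) ->
    exists B, \forall t \near +oo, B <= - h t.
  move=> dh hC; have [C' [M [C'0 M0 HM]]] := quasi_nonincreasing p3 C0 dh hC.
  exists (- (h (M + 1) + C' * cbrt (M + 1) ^ (p + 3))); near=> t.
  rewrite lerN2; apply: le_trans (HM _ t _ _); rewrite ?ltrDl//.
  rewrite lerDl mulr_ge0// exprz_ge0// ltW//.
  by near: t; exact: near_cbrt_gt0.
have [B1 FB1] := lb _ _ dNF fC2; have [B2 FB2] := lb _ _ dF fC1.
have FB1' : \forall t \near +oo, B1 <= F t.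
  by near=> t; rewrite -[F t]opprK; near: t.
have [L FL [C1 LC1]] := quasi_nonincreasing_cvg p3 C0 dF fC1 FB1'.
have [L' FL' [C2 LC2]] := quasi_nonincreasing_cvg p3 C0 dNF fC2 FB2.
have LL : L' = - L by apply: cvg_unique FL' _ => //; exact: cvgN.
exists L => //; exists (`|C1| + `|C2|); near=> t.
have s0 : 0 <= cbrt t ^ (p + 3).
  by rewrite exprz_ge0// ltW//; near: t; exact: near_cbrt_gt0.
rewrite ler_norml mulrDl; apply/andP; split.
  rewrite lerNl opprB.
  have : L - F t <= C1 * cbrt t ^ (p + 3) by near: t.
  move=> /le_trans; apply.
  by rewrite -[leLHS]addr0 lerD ?mulr_ge0// ler_wpM2r// ler_norm.
have -> : F t - L = L' - - F t by rewrite LL; ring.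
apply: (@le_trans _ _ (C2 * cbrt t ^ (p + 3))); first by near: t.
by rewrite -[leLHS]add0r lerD ?mulr_ge0// ler_wpM2r// ler_norm.
Unshelve. all: by end_near. Qed.

(** Barbalat's lemma in logarithmic time.  Comparing F at t and (1 + k) t, the
    mean value theorem produces a point between them where g is small; g moves
    by at most C k meanwhile because g' = O(1/t), and k is arbitrary. *)
Lemma barbalat F g g' e (l : R) :
  (\forall t \near +oo, is_derive (t : R) 1 F ((g t + e t) / t)) ->
  F t @[t --> +oo] --> l -> e t @[t --> +oo] --> 0 ->
  (\forall t \near +oo, is_derive (t : R) 1 g (g' t)) -> growth (- 3%:Z) g' ->
  g t @[t --> +oo] --> 0.
Proof.
move=> dF Fl e0 dg /growth_ge0[C C0 gC].
apply/cvgr0Pnorm_le => d d0.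
have C1 : 0 < C + 1 by lra.
have [k kE] : exists k : R, k = d / (3 * (C + 1)) by exists (d / (3 * (C + 1))).
have k0 : 0 < k by rewrite kE divr_gt0// mulr_gt0.
have [eta etaE] : exists eta : R, eta = d * k / (6 * (1 + k)).
  by exists (d * k / (6 * (1 + k))).
have k1 : 0 < 1 + k by lra.
have eta0 : 0 < eta by rewrite etaE divr_gt0 ?mulr_gt0.
have [M [Mr HM]] : \forall t \near +oo, [/\ 0 < (t : R),
   is_derive t 1 F ((g t + e t) / t), is_derive t 1 g (g' t),
   `|g' t| <= C * cbrt t ^ (- 3%:Z) & `|l - F t| <= eta /\ `|e t| <= d / 3].
  near=> t; split; [|by near: t..|split]; near: t => //.
  - exact: nbhs_pinfty_gt.
  - by move/cvgrPdist_le : Fl; exact.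
  - by move/cvgr0Pnorm_le : e0; apply; rewrite divr_gt0.
have hF t : M < t -> is_derive t 1 F ((g t + e t) / t) by case/HM.
have hg t : M < t -> is_derive t 1 g (g' t) by case/HM.
near=> t.
have Mt : M < t by near: t; exact: nbhs_pinfty_gt.
have [t0 _ _ _ [Ft _]] := HM t Mt.
have tt : t <= t + k * t by rewrite lerDl mulr_ge0 ?ltW.
have [c /andP[tc ct] Ec] := mean_value hF Mt tt.
have [b /andP[tb bc] Eb] := mean_value hg Mt tc.
have Mc := lt_le_trans Mt tc; have Mb := lt_le_trans Mt tb.
have [c0 _ _ _ [_ hec]] := HM c Mc.
have [b0 _ _ hgb _] := HM b Mb.
have [_ _ _ _ [Ftt _]] := HM (t + k * t) (lt_le_trans Mt tt).
(* the mean value equation for F, solved for g at the intermediate time *)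
have Egc : g c = (F (t + k * t) - F t) * (c / (k * t)) - e c.
  by rewrite Ec; field; rewrite !gt_eqF.
have h1 : `|g c| <= d / 3 + d / 3.
  rewrite Egc (le_trans (ler_normB _ _))// lerD// normrM.
  have hc : `|c / (k * t)| <= (1 + k) / k.
    rewrite ger0_norm ?divr_ge0 ?mulr_ge0 ?(ltW c0) ?(ltW k0) ?(ltW t0)//.
    rewrite ler_pdivrMr ?mulr_gt0//.
    by rewrite (le_trans ct)// mulrA divfK ?gt_eqF// mulrDl mul1r.
  apply: (@le_trans _ _ ((eta + eta) * ((1 + k) / k))).
    apply: ler_pM => //.
    have -> : F (t + k * t) - F t = (l - F t) - (l - F (t + k * t)) by ring.
    by rewrite (le_trans (ler_normB _ _))// lerD.
  rewrite etaE le_eqVlt; apply/orP; left; apply/eqP; field.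
  by rewrite !gt_eqF//; lra.
have h2 : `|g c - g t| <= d / 3.
  rewrite Eb normrM (@ger0_norm _ (c - t)) ?subr_ge0//.
  apply: (@le_trans _ _ (C / t * (k * t))).
    apply: ler_pM; rewrite ?subr_ge0//; last by rewrite lerBlDl.
    rewrite (le_trans hgb)// ler_pM2l// -exprnN cbrtK ?(ltW b0)//.
    by rewrite lef_pV2.
  have -> : C / t * (k * t) = C * k by field; rewrite gt_eqF.
  have <- : (C + 1) * k = d / 3 by rewrite kE; field; rewrite gt_eqF.
  by rewrite ler_pM2r// lerDl.
rewrite (_ : g t = g c - (g c - g t)); last by ring.
rewrite (le_trans (ler_normB _ _))// (_ : d = d / 3 + d / 3 + d / 3) ?lerD//.
by field.
Unshelve. all: by end_near. Qed.

End Convergence.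

(** * Newtonian acceleration and potential *)

Section Configurations.
Variables (R : realType) (N : nat) (mu : 'I_N -> R).
Implicit Types (q W : 'M[R]_(N, 2)) (i j : 'I_N) (a : 'I_2).

Definition accel q i a : R :=
  \sum_(j | j != i) mu j * (q j a - q i a) / rdist q i j ^+ 3.

Lemma enorm_ge0 m n (v : 'M[R]_(m, n)) : 0 <= enorm v.
Proof. exact: sqrtr_ge0. Qed.

Lemma enorm_sqr m n (v : 'M[R]_(m, n)) :
  enorm v ^+ 2 = \sum_i \sum_j v i j ^+ 2.
Proof.
by rewrite sqr_sqrtr// sumr_ge0// => i _; rewrite sumr_ge0// => j _; exact: sqr_ge0.
Qed.

Lemma enorm_coord m n (v : 'M[R]_(m, n)) (i : 'I_m) (j : 'I_n) : `|v i j| <= enorm v.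
Proof.
rewrite -ler_sqr ?nnegrE ?enorm_ge0// enorm_sqr real_normK ?num_real//.
rewrite (bigD1 i)//= (bigD1 j)//= -addrA lerDl addr_ge0// sumr_ge0//.
  by move=> b _; exact: sqr_ge0.
by move=> k _; rewrite sumr_ge0// => b _; exact: sqr_ge0.
Qed.

Lemma enormZ m n c (v : 'M[R]_(m, n)) : enorm (c *: v) = `|c| * enorm v.
Proof.
rewrite /enorm -sqrtr_sqr -sqrtrM ?sqr_ge0//; congr Num.sqrt.
rewrite mulr_sumr; apply: eq_bigr => i _; rewrite mulr_sumr.
by apply: eq_bigr => j _; rewrite mxE exprMn.
Qed.

Lemma rdist_ge0 q i j : 0 <= rdist q i j.
Proof. exact: enorm_ge0. Qed.

Lemma rdist_sqr q i j : rdist q i j ^+ 2 = \sum_a (q i a - q j a) ^+ 2.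
Proof. by rewrite enorm_sqr big_ord1; apply: eq_bigr => a _; rewrite !mxE. Qed.

Lemma rdistC q i j : rdist q i j = rdist q j i.
Proof.
by rewrite /rdist -opprB -scaleN1r enormZ normrN1 mul1r.
Qed.

Lemma rdist_coord q i j a : `|q i a - q j a| <= rdist q i j.
Proof. by have := enorm_coord (row i q - row j q) ord0 a; rewrite !mxE. Qed.

Lemma rdist_congr q W i j :
  (forall a, q i a - q j a = W i a - W j a) -> rdist q i j = rdist W i j.
Proof.
move=> qW; rewrite /rdist; congr enorm; apply/rowP => a.
by have := qW a; rewrite !mxE.
Qed.

Lemma rdistZ c q i j : 0 <= c -> rdist (c *: q) i j = c * rdist q i j.
Proof.
move=> c0; rewrite /rdist -[c in RHS]ger0_norm// -enormZ; congr enorm.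
by rewrite scalerBr !linearZ.
Qed.

Lemma collision_freeZ c q : 0 < c -> collision_free q -> collision_free (c *: q).
Proof.
by move=> c0 cf i j ij; rewrite rdistZ ?(ltW c0)// mulf_neq0 ?cf// gt_eqF.
Qed.

Lemma accelZ c q i a : 0 < c -> accel (c *: q) i a = c ^- 2 * accel q i a.
Proof.
move=> c0; rewrite /accel mulr_sumr; apply: eq_bigr => j _.
rewrite rdistZ ?(ltW c0)// !mxE -mulrBr exprMn invfM.
rewrite [c ^- 2](_ : _ = c * c ^- 3); first by ring.
by field; rewrite gt_eqF.
Qed.

Lemma accel_translate q W i a :
  (forall i j a, q i a - q j a = W i a - W j a) -> accel q i a = accel W i a.
Proof.
by move=> qW; apply: eq_bigr => j _; rewrite qW (rdist_congr (qW i j)).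
Qed.

(** Passes from the force picture (ordered pairs of bodies) to the potential
    picture (unordered pairs). *)
Lemma sum_pairs (T : 'I_N -> 'I_N -> R) :
  \sum_i \sum_(j | j != i) T i j =
  \sum_(i < N) \sum_(j < N | (i < j)%N) (T i j + T j i).
Proof.
have -> : \sum_i \sum_(j | j != i) T i j =
    \sum_(i < N) \sum_(j < N | (i < j)%N) T i j +
    \sum_(i < N) \sum_(j < N | (j < i)%N) T i j.
  rewrite -big_split; apply: eq_bigr => i _ /=.
  rewrite (bigID (fun j : 'I_N => (i < j)%N))/=; congr (_ + _); apply: eq_bigl => j.
    by rewrite -val_eqE/=; lia.
  by rewrite -val_eqE/=; lia.
rewrite [X in _ + X](exchange_big_dep predT)//= -big_split.
by apply: eq_bigr => i _; rewrite -big_split.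
Qed.

(** Newton's third law: pairing the forces of i and j leaves only relative
    positions and relative directions.  The derivative of the potential, the
    virial identity and momentum conservation are the cases where W is a
    velocity, the configuration itself and a translation. *)
Lemma accel_dot q W :
  \sum_i \sum_a mu i * accel q i a * W i a =
  - \sum_(i < N) \sum_(j < N | (i < j)%N) mu i * mu j *
     (\sum_a (q i a - q j a) * (W i a - W j a)) / rdist q i j ^+ 3.
Proof.
pose T i j := \sum_a mu i * mu j * (q j a - q i a) * W i a / rdist q i j ^+ 3.
transitivity (\sum_i \sum_(j | j != i) T i j).
  apply: eq_bigr => i _; rewrite exchange_big/=; apply: eq_bigr => a _.
  rewrite mulr_sumr mulr_suml; apply: eq_bigr => j _; ring.
rewrite sum_pairs -sumrN; apply: eq_bigr => i _.
rewrite -sumrN; apply: eq_bigr => j _.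
rewrite /T (rdistC q j i) -big_split mulr_sumr mulr_suml -sumrN.
by apply: eq_bigr => a _ /=; ring.
Qed.

(** Euler's identity for the potential, homogeneous of degree -1. *)
Lemma accel_virial q : collision_free q ->
  \sum_i \sum_a mu i * accel q i a * q i a = - potential mu q.
Proof.
move=> cf; rewrite accel_dot; congr (- _); apply: eq_bigr => i _.
apply: eq_bigr => j ij; under eq_bigr do rewrite -expr2.
rewrite -rdist_sqr; field.
by apply: cf; rewrite -val_eqE/= ltn_eqF.
Qed.

Lemma sum_mu_accel q a : \sum_i mu i * accel q i a = 0.
Proof.
have := accel_dot q (\matrix_(i, b) (b == a)%:R).
under [X in X = _]eq_bigr => i _.
  rewrite (bigD1 a)//= mxE eqxx mulr1 big1 ?addr0; last first.
    by move=> b ba; rewrite mxE (negPf ba) mulr0.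
  over.
move=> ->; rewrite big1 ?oppr0// => i _; rewrite big1// => j _.
by rewrite big1 ?mulr0 ?mul0r// => b _; rewrite !mxE subrr mulr0.
Qed.

End Configurations.

Section Derivatives.
Variables (R : realType) (N : nat) (mu : 'I_N -> R).
Implicit Types (X : R -> 'M[R]_(N, 2)) (V q : 'M[R]_(N, 2)) (t : R).

Lemma is_derive1V (f : R -> R) t df : f t != 0 -> is_derive t 1 f df ->
  is_derive t 1 (fun s => (f s)^-1) (- df / f t ^+ 2).
Proof.
move=> f0 [df1 df2]; apply: DeriveDef; first exact: derivableV.
by rewrite deriveV// df2 /GRing.scale/=; field.
Qed.

Lemma is_derive1_sqrtf (f : R -> R) t df : 0 < f t -> is_derive t 1 f df ->
  is_derive t 1 (fun s => Num.sqrt (f s)) (df / (2 * Num.sqrt (f t))).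
Proof.
move=> f0 df1; have ds := is_derive1_sqrt f0.
apply: (is_derive_eq (is_derive1_comp ds df1)).
by rewrite mulrC.
Qed.

Lemma is_derive_rdist X V t i j : rdist (X t) i j != 0 ->
  (forall i a, is_derive t 1 (fun s => X s i a) (V i a)) ->
  is_derive t 1 (fun s => rdist (X s) i j)
    ((\sum_a (X t i a - X t j a) * (V i a - V j a)) / rdist (X t) i j).
Proof.
move=> r0 dX.
have -> : (fun s => rdist (X s) i j) =
    (fun s => Num.sqrt (\sum_a (X s i a - X s j a) ^+ 2)).
  by apply/funext => s; rewrite -rdist_sqr sqrtr_sqr ger0_norm// rdist_ge0.
have rE : \sum_a (X t i a - X t j a) ^+ 2 = rdist (X t) i j ^+ 2.
  by rewrite rdist_sqr.
have S0 : 0 < \sum_a (X t i a - X t j a) ^+ 2.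
  by rewrite rE exprn_gt0// lt_def r0 rdist_ge0.
have dS : is_derive t 1 (fun s => \sum_a (X s i a - X s j a) ^+ 2)
    (\sum_a 2 * (X t i a - X t j a) * (V i a - V j a)).
  apply: is_derive1_sum => a _.
  exact: (is_derive1sqr (is_derive1B (dX i a) (dX j a))).
apply: (is_derive_eq (is_derive1_sqrtf S0 dS)).
rewrite rE sqrtr_sqr ger0_norm ?rdist_ge0//.
under eq_bigr do rewrite -mulrA; rewrite -mulr_sumr.
by field.
Qed.

Lemma is_derive_potential X V t : collision_free (X t) ->
  (forall i a, is_derive t 1 (fun s => X s i a) (V i a)) ->
  is_derive t 1 (fun s => potential mu (X s))
    (\sum_i \sum_a mu i * accel mu (X t) i a * V i a).
Proof.
move=> cf dX; rewrite accel_dot -sumrN.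
apply: is_derive1_sum => i _; rewrite -sumrN; apply: is_derive1_sum => j ij.
have r0 : rdist (X t) i j != 0 by apply: cf; rewrite -val_eqE/= ltn_eqF.
have dV := @is_derive1V (fun s => rdist (X s) i j) t _ r0 (is_derive_rdist r0 dX).
apply: (is_derive_eq (is_derive1cM (mu i * mu j) dV)).
by field.
Qed.

(** The directional derivative is the derivative of the potential along a
    straight line, a special case of [is_derive_potential]. *)
Lemma grad_potentialE q i a : collision_free q ->
  grad_potential mu q i 0 a = mu i * accel mu q i a.
Proof.
move=> cf; rewrite mxE.
pose X (h : R) := h *: delta_mx i a + q.
have X0 : X 0 = q by rewrite /X scale0r add0r.
have dX j b : is_derive (0 : R) 1 (fun h => X h j b) (delta_mx i a j b : R).
  rewrite (_ : (fun h => X h j b) = fun h => delta_mx i a j b * h + q j b).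
    have := is_derive1D (is_derive1cM (delta_mx i a j b) (is_derive_id (0 : R) 1))
      (is_derive_cst (q j b) (0 : R) 1).
    by rewrite mulr1 addr0.
  by apply/funext => h; rewrite !mxE mulrC.
have := @is_derive_potential X (delta_mx i a) 0; rewrite X0 => /(_ cf dX) dU.
have -> : 'D_(delta_mx i a) (potential mu) q =
    'D_1 (fun s => potential mu (X s)) (0 : R).
  have -> : (fun s => potential mu (X s)) =
    (fun h => potential mu (h *: delta_mx i a + q)) by [].
  rewrite /derive; set f := (fun h => _); set g := (fun h => _).
  suff -> : f = g by [].
  apply/funext => h; rewrite /f /g /=.
  by rewrite scale0r add0r addr0 [h *: 1]mulr1.
rewrite derive_val (bigD1 i)//= (bigD1 a)//= !mxE !eqxx mulr1.
rewrite big1 ?addr0; last by move=> b ba; rewrite !mxE eqxx (negPf ba) mulr0.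
rewrite big1 ?addr0// => j ji; rewrite big1// => b _.
by rewrite !mxE (negPf ji) mulr0.
Qed.

End Derivatives.

(** * Perturbed N-body dynamics on the parabolic scale *)

Section Dynamics.
Variables (R : realType) (N : nat) (mu : 'I_N -> R).
Hypothesis mu_gt0 : forall i, 0 < mu i.
Variables X V f : R -> 'M[R]_(N, 2).
Hypothesis dX : \forall t \near +oo, forall i a,
  is_derive (t : R) 1 (fun s => X s i a) (V t i a).
Hypothesis dV : \forall t \near +oo, forall i a,
  is_derive (t : R) 1 (fun s => V s i a) (accel mu (X t) i a + f t i a).
Hypothesis X_growth : forall i a, growth 2 (fun t => X t i a).
Hypothesis f_growth : forall i a, growth (- 7%:Z) (fun t => f t i a).
Variable c : R.
Hypothesis c_gt0 : 0 < c.
Hypothesis X_apart : \forall t \near +oo, forall i j, i != j ->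
  c * cbrt (t : R) ^+ 2 <= rdist (X t) i j.

Lemma near_rdist_gt0 : \forall t \near +oo, forall i j, i != j ->
  0 < rdist (X t) i j.
Proof.
near=> t => i j ij.
have s0 : 0 < cbrt t by near: t; exact: near_cbrt_gt0.
apply: (@lt_le_trans _ _ (c * cbrt t ^+ 2)); first by rewrite mulr_gt0// exprn_gt0.
by move: i j ij; near: t.
Unshelve. all: by end_near. Qed.

Lemma near_collision_free : \forall t \near +oo, collision_free (X t).
Proof.
near=> t => i j ij; rewrite gt_eqF//.
by move: i j ij; near: t; exact: near_rdist_gt0.
Unshelve. all: by end_near. Qed.

Lemma invr_rdist_growth i j : i != j ->
  growth (- 2%:Z) (fun t => (rdist (X t) i j)^-1).
Proof.
move=> ij; exists c^-1; near=> t.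
have s0 : 0 < cbrt t by near: t; exact: near_cbrt_gt0.
have r0 : 0 < rdist (X t) i j.
  by move: i j ij; near: t; exact: near_rdist_gt0.
rewrite normfV ger0_norm ?(ltW r0)// -exprnN -invfM.
rewrite lef_pV2 ?posrE ?mulr_gt0 ?exprn_gt0//.
by move: i j ij {r0}; near: t.
Unshelve. all: by end_near. Qed.

Lemma accel_growth i a : growth (- 4%:Z) (fun t => accel mu (X t) i a).
Proof.
apply: growth_sum => j ji.
apply: (growth_near (f := fun t => mu j * ((X t j a - X t i a) *
  ((rdist (X t) i j)^-1 * ((rdist (X t) i j)^-1 * (rdist (X t) i j)^-1))))).
  by near=> t; rewrite -mulrA; congr (_ * (_ * _)); rewrite -exprVn; ring.
have rV := @invr_rdist_growth i j; rewrite eq_sym ji in rV.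
apply: growthZ; apply: (@growthM _ 2 (- 6%:Z)) => //; first exact: growthB.
apply: (@growthM _ (- 2%:Z) (- 4%:Z)) => //; first exact: rV.
by apply: (@growthM _ (- 2%:Z) (- 2%:Z)) => //; exact: rV.
Unshelve. all: by end_near. Qed.

Lemma potential_growth : growth (- 2%:Z) (fun t => potential mu (X t)).
Proof.
apply: growth_sum => i _; apply: growth_sum => j ij; apply: growthZ.
by apply: invr_rdist_growth; rewrite -val_eqE/= ltn_eqF.
Qed.

Definition kinetic t : R := \sum_i \sum_a mu i / 2 * V t i a ^+ 2.
Definition total_energy t : R := kinetic t - potential mu (X t).
Definition tidal_power t : R := \sum_i \sum_a mu i * V t i a * f t i a.

Lemma kinetic_ge0 t : 0 <= kinetic t.
Proof.
apply: sumr_ge0 => i _; apply: sumr_ge0 => a _.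
by rewrite mulr_ge0 ?sqr_ge0// divr_ge0// ltW.
Qed.

Lemma velocity_kinetic t i a : mu i / 2 * V t i a ^+ 2 <= kinetic t.
Proof.
have T0 j b : 0 <= mu j / 2 * V t j b ^+ 2.
  by rewrite mulr_ge0 ?sqr_ge0// divr_ge0// ltW.
rewrite /kinetic (bigD1 i)//= (bigD1 a)//= -addrA lerDl addr_ge0// sumr_ge0//.
by move=> j _; exact: sumr_ge0.
Qed.

Lemma is_derive_energy : \forall t \near +oo,
  is_derive (t : R) 1 total_energy (tidal_power t).
Proof.
near=> t.
have dXt : forall i a, is_derive t 1 (fun s => X s i a) (V t i a) by near: t.
have dVt : forall i a, is_derive t 1 (fun s => V s i a)
  (accel mu (X t) i a + f t i a) by near: t.
have cf : collision_free (X t) by near: t; exact: near_collision_free.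
have dK : is_derive t 1 kinetic (\sum_i \sum_a mu i / 2 *
    (2 * V t i a * (accel mu (X t) i a + f t i a))).
  apply: is_derive1_sum => i _; apply: is_derive1_sum => a _.
  exact: (is_derive1cM (mu i / 2) (is_derive1sqr (dVt i a))).
apply: (is_derive_eq (is_derive1B dK (is_derive_potential mu cf dXt))).
rewrite /tidal_power -sumrB; apply: eq_bigr => i _.
by rewrite -sumrB; apply: eq_bigr => a _; field.
Unshelve. all: by end_near. Qed.

Lemma tidal_power_growth p :
  (forall i a, growth p (fun t => V t i a)) -> growth (p - 7%:Z) tidal_power.
Proof.
move=> Vp; apply: growth_sum => i _; apply: growth_sum => a _.
by apply: (@growthM _ p (- 7%:Z)) => //; exact: growthZ.
Qed.

(** Gronwall: with g = h + const at least 1 + kinetic energy, the velocities are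
    O(g), so (ln g)' = h' / g = O(s^-7) is integrable and g stays bounded. *)
Lemma velocity_bounded i a : growth 0 (fun t => V t i a).
Proof.
have /growth_ge0[B B0 UB] : growth 0 (fun t => potential mu (X t)).
  exact: growth_weaken potential_growth.
pose g t := total_energy t + (B + 1).
have gK : \forall t \near +oo, 1 + kinetic t <= g t.
  near=> t; have : `|potential mu (X t)| <= B * cbrt t ^ 0 by near: t.
  rewrite expr0z mulr1 => /(le_trans (ler_norm _)).
  by rewrite /g /total_energy; lra.
have Vg j b : growth 0 (fun t => V t j b / g t).
  exists (1 + 2 / mu j); near=> t; rewrite expr0z mulr1.
  have gt : 1 + kinetic t <= g t by near: t.
  have K0 := kinetic_ge0 t.
  have g0 : 0 < g t by rewrite (lt_le_trans _ gt)// ltr_wpDr.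
  rewrite normrM normfV (ger0_norm (ltW g0)) ler_pdivrMr//.
  have m0 := mu_gt0 j.
  have V2 : V t j b ^+ 2 <= 2 / mu j * kinetic t.
    have -> : V t j b ^+ 2 = 2 / mu j * (mu j / 2 * V t j b ^+ 2).
      by field; rewrite gt_eqF.
    by rewrite ler_pM2l ?divr_gt0// velocity_kinetic.
  have V1 : `|V t j b| <= 1 + V t j b ^+ 2.
    rewrite -(real_normK (num_real (V t j b))).
    have := sqr_ge0 (`|V t j b| - 1); have := normr_ge0 (V t j b); nra.
  have m1 : 0 < 2 / mu j by rewrite divr_gt0.
  apply: (le_trans V1); apply: (@le_trans _ _ ((1 + 2 / mu j) * (1 + kinetic t))).
    by move: V2 K0 m1; nra.
  by rewrite ler_pM2l// addr_gt0.
have dln : \forall t \near +oo,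
    is_derive (t : R) 1 (fun s => ln (g s)) (tidal_power t / g t).
  near=> t.
  have gt : 1 + kinetic t <= g t by near: t.
  have g0 : 0 < g t by rewrite (lt_le_trans _ gt)// ltr_wpDr// kinetic_ge0.
  have dh : is_derive t 1 total_energy (tidal_power t) by near: t; exact: is_derive_energy.
  have dg := is_derive1D dh (is_derive_cst (B + 1) t 1).
  apply: (is_derive_eq (is_derive1_comp (is_derive1_ln g0) dg)).
  by rewrite addr0 mulrC.
have pg : growth (- 7%:Z) (fun t => tidal_power t / g t).
  apply: (growth_near (f := fun t =>
      \sum_i \sum_a mu i * ((V t i a / g t) * f t i a))).
    near=> t; rewrite mulr_suml; apply: eq_bigr => j _; rewrite mulr_suml.
    by apply: eq_bigr => b _; ring.
  apply: growth_sum => j _; apply: growth_sum => b _; apply: growthZ.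
  exact: (@growthM _ 0 (- 7%:Z)).
have [//|L _ lnL] := growth_primitive _ dln pg.
have /growth_ge0[C C0 lnC] : growth 0 (fun t => ln (g t)).
  apply: (growth_near (f := fun t => (ln (g t) - L) + L)).
    by near=> t; rewrite subrK.
  by apply: growthD (growth_cst L); exact: growth_weaken lnL.
have gb : growth 0 g.
  exists (expR C); near=> t; rewrite expr0z mulr1.
  have gt : 1 + kinetic t <= g t by near: t.
  have g0 : 0 < g t by rewrite (lt_le_trans _ gt)// ltr_wpDr// kinetic_ge0.
  rewrite ger0_norm ?(ltW g0)// -[g t]lnK ?posrE// ler_expR.
  rewrite (le_trans (ler_norm _))//.
  have : `|ln (g t)| <= C * cbrt t ^ 0 by near: t.
  by rewrite expr0z mulr1.
apply: (growth_near (f := fun t => V t i a / g t * g t)).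
  near=> t; rewrite divfK//.
  have gt : 1 + kinetic t <= g t by near: t.
  by rewrite gt_eqF// (lt_le_trans _ gt)// ltr_wpDr// kinetic_ge0.
exact: (@growthM _ 0 0).
Unshelve. all: by end_near. Qed.

(** Half the derivative of the moment of inertia. *)
Definition virial t : R := \sum_i \sum_a mu i * (X t i a * V t i a).
Definition tidal_virial t : R := \sum_i \sum_a mu i * (X t i a * f t i a).

(** Lagrange-Jacobi identity. *)
Lemma is_derive_virial : \forall t \near +oo,
  is_derive (t : R) 1 virial (kinetic t + total_energy t + tidal_virial t).
Proof.
near=> t.
have dXt : forall i a, is_derive t 1 (fun s => X s i a) (V t i a) by near: t.
have dVt : forall i a, is_derive t 1 (fun s => V s i a)
  (accel mu (X t) i a + f t i a) by near: t.
have cf : collision_free (X t) by near: t; exact: near_collision_free.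
have dJ : is_derive t 1 virial (\sum_i \sum_a mu i *
    (V t i a * V t i a + X t i a * (accel mu (X t) i a + f t i a))).
  apply: is_derive1_sum => i _; apply: is_derive1_sum => a _.
  exact: (is_derive1cM (mu i) (is_derive1M (dXt i a) (dVt i a))).
apply: (is_derive_eq dJ).
rewrite /total_energy -(accel_virial mu cf) addrA /kinetic /tidal_virial.
rewrite -!big_split; apply: eq_bigr => i _; rewrite -!big_split.
by apply: eq_bigr => a _ /=; field.
Unshelve. all: by end_near. Qed.

Lemma tidal_virial_growth : growth (- 5%:Z) tidal_virial.
Proof.
apply: growth_sum => i _; apply: growth_sum => a _; apply: growthZ.
exact: (@growthM _ 2 (- 7%:Z)).
Qed.

Lemma virial_growth p : (forall i a, growth p (fun t => V t i a)) ->
  growth (2 + p) virial.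
Proof.
move=> Vp; apply: growth_sum => i _; apply: growth_sum => a _; apply: growthZ.
exact: (@growthM _ 2 p).
Qed.

(** With a positive limit energy the virial would grow at least linearly in t,
    while it is O(t^(2/3)) since the velocities are bounded. *)
Lemma energy_cvg_le0 L : total_energy t @[t --> +oo] --> L -> L <= 0.
Proof.
move=> hL; rewrite leNgt; apply/negP => L0.
have L4 : 0 < L / 4 by rewrite divr_gt0.
have e0 := growth_cvg0 (isT : - 5%:Z < 0) tidal_virial_growth.
pose b : R := L / 2; have b0 : 0 < b by rewrite divr_gt0.
have : \forall t \near +oo, is_derive (t : R) 1 virial
    (kinetic t + total_energy t + tidal_virial t) /\
    b <= kinetic t + total_energy t + tidal_virial t.
  near=> t; split; first by near: t; exact: is_derive_virial.
  have h1 : `|L - total_energy t| <= L / 4.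
    by near: t; move/cvgrPdist_le : hL; apply.
  have h2 : `|tidal_virial t| <= L / 4.
    by near: t; move/cvgr0Pnorm_le : e0; apply.
  have K0 := kinetic_ge0 t.
  move: h1 h2; rewrite !ler_norml => /andP[_ h1] /andP[h2 _].
  by rewrite /b; lra.
move=> [M [Mr HM]].
have J0 : growth (- 1%:Z) (fun t => virial t * cbrt t ^ (- 3%:Z)).
  apply: (@growthM _ (2 + 0) (- 3%:Z)) => //; last exact: growth_cbrt.
  exact: (virial_growth velocity_bounded).
have {J0} J0 := growth_cvg0 (isT : - 1%:Z < 0) J0.
have b2 : 0 < b / 2 by rewrite divr_gt0.
move/cvgr0Pnorm_le : J0 => /(_ _ b2) J0.
pose s := M + 1.
pose D : R := 2 * (b * s - virial s) / b.
near (pinfty_nbhs R) => t.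
have t0 : 0 < t by near: t; exact: nbhs_pinfty_gt.
have st : s <= t by near: t; apply: nbhs_pinfty_ge; exact: num_real.
have Dt : D < t by near: t; apply: nbhs_pinfty_gt; exact: num_real.
have Ms : M < s by rewrite ltrDl.
have [x /andP[sx xt] E] := mean_value (fun x Mx => (HM x Mx).1) Ms st.
have bx := (HM x (lt_le_trans Ms sx)).2.
have h1 : b * (t - s) <= virial t - virial s.
  by rewrite E ler_wpM2r// subr_ge0.
have h2 : virial t <= b / 2 * t.
  have : `|virial t * cbrt t ^ (- 3%:Z)| <= b / 2 by near: t.
  rewrite -exprnN cbrtK ?(ltW t0)// => /(le_trans (ler_norm _)).
  by rewrite ler_pdivrMr.
move: Dt; rewrite /D ltr_pdivrMr// => Dt.
have h3 : b * t <= 2 * (b * s - virial s).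
  have -> : b * t = 2 * (b * t - b / 2 * t) by field.
  by rewrite ler_pM2l//; move: h1 h2; rewrite mulrBr; lra.
by move: Dt; rewrite ltNge (mulrC t) h3.
Unshelve. all: by end_near. Qed.

Lemma energy_cvg0 L : total_energy t @[t --> +oo] --> L -> L = 0.
Proof.
move=> hL; apply/eqP; rewrite eq_le energy_cvg_le0//=.
have U0 := growth_cvg0 (isT : - 2%:Z < 0) potential_growth.
have hU : total_energy t + potential mu (X t) @[t --> +oo] --> L.
  by rewrite -[L]addr0; exact: cvgD.
apply: (ler_cvg_to (cvg_cst 0) hU).
by near=> t; rewrite /total_energy subrK kinetic_ge0.
Unshelve. all: by end_near. Qed.

(** Bootstrap step from velocities to energy, used with p = 0 and then p = -1. *)
Lemma energy_decay p : (forall i a, growth p (fun t => V t i a)) -> p <= 0 ->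
  growth (p - 4%:Z) total_energy.
Proof.
move=> Vp p0.
have p7 : p - 7%:Z < - 3%:Z by lia.
have [L hL] := growth_primitive p7 is_derive_energy (tidal_power_growth Vp).
rewrite (energy_cvg0 hL) (_ : p - 7%:Z + 3%:Z = p - 4%:Z); last by lia.
by apply: growth_near; near=> t; rewrite subr0.
Unshelve. all: by end_near. Qed.

Lemma velocity_growth i a : growth (- 1%:Z) (fun t => V t i a).
Proof.
have Kg : growth (- 2%:Z) kinetic.
  apply: (growth_near (f := fun t => total_energy t + potential mu (X t))).
    by near=> t; rewrite /total_energy subrK.
  apply: growthD potential_growth.
  exact: growth_weaken (energy_decay velocity_bounded (lexx 0)).
apply: growth_sqr; apply: (growth_le_near (f := fun t => 2 / mu i * kinetic t)).
  near=> t; rewrite ger0_norm ?sqr_ge0// ger0_norm; last first.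
    by rewrite mulr_ge0 ?kinetic_ge0// divr_ge0// ltW.
  have -> : V t i a ^+ 2 = 2 / mu i * (mu i / 2 * V t i a ^+ 2).
    by field; rewrite gt_eqF.
  by rewrite ler_pM2l ?divr_gt0// velocity_kinetic.
exact: growthZ.
Unshelve. all: by end_near. Qed.

Lemma energy_growth : growth (- 5%:Z) total_energy.
Proof. exact: (energy_decay velocity_growth). Qed.

(** The derivative, with respect to ln t, of the blown-up configuration
    t^(-2/3) X. *)
Definition drift t i a : R :=
  cbrt t * V t i a - 2 / 3 * (cbrt t ^ (- 2%:Z) * X t i a).

Definition drift_norm2 t : R := \sum_i \sum_a mu i * drift t i a ^+ 2.

Definition inertia2 t : R := \sum_i \sum_a mu i * X t i a ^+ 2.

(** The energy |W|^2 / 2 - U(Z) - |Z|^2 / 9 of the blown-up system, written in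
    terms of energy, virial and inertia of the original one. *)
Definition scaled_energy t : R :=
  cbrt t ^ 2 * total_energy t - 2 / 3 * (cbrt t ^ (- 1%:Z) * virial t)
  + 1 / 9 * (cbrt t ^ (- 4%:Z) * inertia2 t).

Definition scaled_work t : R :=
  cbrt t ^ 2 * tidal_power t - 2 / 3 * (cbrt t ^ (- 1%:Z) * tidal_virial t).

(** (2 / 9) Z plus the acceleration at Z = t^(-2/3) X: it vanishes exactly when Z
    solves the central configuration equation with multiplier 2 / 9. *)
Definition defect t i a : R :=
  2 / 9 * (cbrt t ^ (- 2%:Z) * X t i a) + cbrt t ^ 4 * accel mu (X t) i a.

Lemma growth_cbrt1 : growth 1 (@cbrt R).
Proof.
apply: (growth_near (f := fun t : R => cbrt t ^ 1)); last exact: growth_cbrt.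
by near=> t; rewrite expr1z.
Unshelve. all: by end_near. Qed.

Lemma drift_growth i a : growth 0 (fun t => drift t i a).
Proof.
apply: growthB; first exact: (growthM _ growth_cbrt1 (velocity_growth i a)).
apply: growthZ; exact: (growthM _ (growth_cbrt _ (- 2%:Z)) (X_growth i a)).
Qed.

Lemma is_derive_cbrt (t : R) : 0 < t ->
  is_derive t 1 (@cbrt R) (1 / 3 * cbrt t ^ (- 2%:Z)).
Proof.
move=> t0; have := is_derive_cbrtX 1 t0.
by rewrite (_ : (fun s => cbrt s ^ 1) = @cbrt R)//; apply/funext => s; rewrite expr1z.
Qed.

(** Newton's equations in blown-up coordinates and logarithmic time, the term
    - W / 3 being the friction. *)
Lemma is_derive_drift : \forall t \near +oo, forall i a,
  is_derive (t : R) 1 (fun s => drift s i a)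
   ((defect t i a + (cbrt t ^ 4 * f t i a - 1 / 3 * drift t i a)) / t).
Proof.
near=> t => i a.
have dXt : is_derive t 1 (fun s => X s i a) (V t i a).
  by move: i a; near: t.
have dVt : is_derive t 1 (fun s => V s i a) (accel mu (X t) i a + f t i a).
  by move: i a {dXt}; near: t.
have t0 : 0 < t by near: t; exact: nbhs_pinfty_gt.
have s0 := cbrt_gt0 t0.
apply: (is_derive_eq (is_derive1B (is_derive1M (is_derive_cbrt t0) dVt)
  (is_derive1cM (2 / 3) (is_derive1M (is_derive_cbrtX (- 2%:Z) t0) dXt)))).
have -> : t^-1 = (cbrt t)^-1 ^+ 3 by rewrite exprVn cbrtK ?(ltW t0).
rewrite /defect /drift.
have e5 : cbrt t ^ (- 2%:Z - 3) = (cbrt t)^-1 ^+ 5 by rewrite exprVn exprnN.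
have e2 : cbrt t ^ (- 2%:Z) = (cbrt t)^-1 ^+ 2 by rewrite exprVn exprnN.
rewrite e5 e2 -[cbrt t ^ 4]/(cbrt t ^+ 4).
by field; rewrite gt_eqF.
Unshelve. all: by end_near. Qed.

(** Friction dissipates the scaled energy at rate |W|^2 / 3 in logarithmic time. *)
Lemma is_derive_scaled_energy : \forall t \near +oo,
  is_derive (t : R) 1 scaled_energy
   ((- (1 / 3) * drift_norm2 t + t * scaled_work t) / t).
Proof.
near=> t.
have dXt : forall i a, is_derive t 1 (fun s => X s i a) (V t i a) by near: t.
have t0 : 0 < t by near: t; exact: nbhs_pinfty_gt.
have s0 := cbrt_gt0 t0.
have dh : is_derive t 1 total_energy (tidal_power t) by near: t; exact: is_derive_energy.
have dJ : is_derive t 1 virial (kinetic t + total_energy t + tidal_virial t).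
  by near: t; exact: is_derive_virial.
have dQ : is_derive t 1 inertia2 (2 * virial t).
  have dQ' : is_derive t 1 inertia2 (\sum_i \sum_a mu i * (2 * X t i a * V t i a)).
    apply: is_derive1_sum => i _; apply: is_derive1_sum => a _.
    exact: (is_derive1cM (mu i) (is_derive1sqr (dXt i a))).
  apply: (is_derive_eq dQ'); rewrite mulr_sumr; apply: eq_bigr => i _.
  rewrite mulr_sumr.
  by apply: eq_bigr => a _; ring.
have d1 := is_derive1M (is_derive_cbrtX 2 t0) dh.
have d2 := is_derive1cM (2 / 3) (is_derive1M (is_derive_cbrtX (- 1%:Z) t0) dJ).
have d3 := is_derive1cM (1 / 9) (is_derive1M (is_derive_cbrtX (- 4%:Z) t0) dQ).
apply: (is_derive_eq (is_derive1D (is_derive1B d1 d2) d3)).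
(* expanding |W|^2 makes the claim polynomial in s, 1/s and the integrals *)
have GE : drift_norm2 t = cbrt t ^+ 2 * (2 * kinetic t)
    - 4 / 3 * (cbrt t)^-1 * virial t + 4 / 9 * (cbrt t)^-1 ^+ 4 * inertia2 t.
  rewrite /drift_norm2 /kinetic /virial /inertia2.
  rewrite !mulr_sumr -sumrB -big_split/=; apply: eq_bigr => i _.
  rewrite !mulr_sumr -sumrB -big_split/=; apply: eq_bigr => a _.
  rewrite /drift (_ : cbrt t ^ (- 2%:Z) = (cbrt t)^-1 ^+ 2) ?exprVn ?exprnN//.
  by rewrite -?exprnN; field; rewrite gt_eqF.
rewrite GE /scaled_work.
have eN n : cbrt t ^ (- n%:Z) = (cbrt t)^-1 ^+ n by rewrite exprVn exprnN.
have -> : t^-1 = (cbrt t)^-1 ^+ 3 by rewrite exprVn cbrtK ?(ltW t0).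
have -> (x : R) : t * x = cbrt t ^+ 3 * x by rewrite cbrtK ?(ltW t0).
rewrite -[cbrt t ^ (- 1%:Z - 3)]/(cbrt t ^ (- 4%:Z)).
rewrite -[cbrt t ^ (- 4%:Z - 3)]/(cbrt t ^ (- 7%:Z)).
rewrite -[cbrt t ^ (2%:Z - 3)]/(cbrt t ^ (- 1%:Z)).
rewrite !eN -[cbrt t ^ 2]/(cbrt t ^+ 2).
have -> : kinetic t = total_energy t + potential mu (X t) by rewrite subrK.
by field; rewrite gt_eqF.
Unshelve. all: by end_near. Qed.

Lemma virial_growth1 : growth 1 virial.
Proof. exact: (virial_growth velocity_growth). Qed.

Lemma scaled_work_growth : growth (- 6%:Z) scaled_work.
Proof.
apply: growthB.
  exact: (growthM _ (growth_cbrt _ 2) (tidal_power_growth velocity_growth)).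
apply: growthZ; exact: (growthM _ (growth_cbrt _ (- 1%:Z)) tidal_virial_growth).
Qed.

Lemma scaled_energy_growth : growth 0 scaled_energy.
Proof.
apply: growthD; first apply: growthB.
- apply: (@growth_weaken _ (2 - 5%:Z)) => //.
  exact: (growthM _ (growth_cbrt _ 2) energy_growth).
- by apply/growthZ/(growthM _ (growth_cbrt _ (- 1%:Z)) virial_growth1).
- apply/growthZ/(growthM _ (growth_cbrt _ (- 4%:Z))) => //; first exact: addNr.
  apply: growth_sum => i _; apply: growth_sum => a _; apply: growthZ.
  exact: (@growthM _ 2 2 4 (fun t => X t i a) (fun t => X t i a)).
Qed.

Lemma scaled_energy_cvg : exists L : R, scaled_energy t @[t --> +oo] --> L.
Proof.
have [C C0 wC] := growth_ge0 scaled_work_growth.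
have [B B0 EB] := growth_ge0 scaled_energy_growth.
have fC : \forall t \near +oo,
    (- (1 / 3) * drift_norm2 t + t * scaled_work t) / t <= C * cbrt t ^ (- 6%:Z).
  near=> t.
  have t0 : 0 < t by near: t; exact: nbhs_pinfty_gt.
  have G0 : 0 <= drift_norm2 t.
    apply: sumr_ge0 => i _; apply: sumr_ge0 => a _.
    by rewrite mulr_ge0 ?sqr_ge0// ltW.
  apply: (@le_trans _ _ (scaled_work t)).
    rewrite ler_pdivrMr// (mulrC _ t) gerDr.
    by rewrite mulNr oppr_le0 mulr_ge0// divr_ge0.
  by rewrite (le_trans (ler_norm _))//; near: t.
have EB' : \forall t \near +oo, - B <= scaled_energy t.
  near=> t; have : `|scaled_energy t| <= B * cbrt t ^ 0 by near: t.
  by rewrite expr0z mulr1 ler_norml => /andP[].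
have [//|L EL _] :=
  quasi_nonincreasing_cvg _ (ltW C0) is_derive_scaled_energy fC EB'.
by exists L.
Unshelve. all: by end_near. Qed.

(** [barbalat] for the convergent scaled energy, whose derivative in ln t is
    - |W|^2 / 3 up to a decaying error. *)
Lemma drift_cvg0 i a : drift t i a @[t --> +oo] --> 0.
Proof.
have [L EL] := scaled_energy_cvg.
have e0 : growth (- 3%:Z) (fun t => t * scaled_work t).
  apply: (growth_near (f := fun t => cbrt t ^ 3 * scaled_work t)).
    near=> t; rewrite -[cbrt t ^ 3]/(cbrt t ^+ 3) cbrtK//.
  exact: (growthM _ (growth_cbrt _ 3) scaled_work_growth).
pose W' t j b := (defect t j b + (cbrt t ^ 4 * f t j b - 1 / 3 * drift t j b)) / t.
have W'g j b : growth (- 3%:Z) (fun t => W' t j b).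
  apply: (growth_near (f := fun t => cbrt t ^ (- 3%:Z) * (defect t j b +
      (cbrt t ^ 4 * f t j b - 1 / 3 * drift t j b)))).
    near=> t; rewrite /W' mulrC -exprnN cbrtK//.
  apply: (growthM (q := 0) _ (growth_cbrt _ (- 3%:Z))) => //.
  apply: growthD; first apply: growthD.
  - by apply/growthZ/(growthM _ (growth_cbrt _ (- 2%:Z)) (X_growth j b)).
  - by apply: (growthM _ (growth_cbrt _ 4) (accel_growth j b)).
  - apply: growthB; last exact/growthZ/drift_growth.
    apply: (@growth_weaken _ (4 - 7%:Z)) => //.
    exact: (growthM _ (growth_cbrt _ 4) (f_growth j b)).
have dG : \forall t \near +oo, is_derive (t : R) 1
    (fun s => - (1 / 3) * drift_norm2 s)
    (- (1 / 3) * \sum_j \sum_b mu j * (2 * drift t j b * W' t j b)).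
  near=> t; apply: is_derive1cM.
  apply: is_derive1_sum => j _; apply: is_derive1_sum => b _.
  apply: is_derive1cM; apply: is_derive1sqr.
  by move: j b; near: t; exact: is_derive_drift.
have Gg : growth (- 3%:Z) (fun t =>
    - (1 / 3) * \sum_j \sum_b mu j * (2 * drift t j b * W' t j b)).
  apply: growthZ; apply: growth_sum => j _; apply: growth_sum => b _.
  apply: growthZ; apply: (@growthM _ 0 (- 3%:Z)) => //.
  exact/growthZ/drift_growth.
have := barbalat is_derive_scaled_energy EL
  (growth_cvg0 (isT : - 3%:Z < 0) e0) dG Gg.
move=> /cvgr0Pnorm_le G0; apply/cvgr0Pnorm_le => e e_gt0.
have d0 : 0 < 1 / 3 * (mu i * e ^+ 2) by rewrite !mulr_gt0// exprn_gt0.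
near=> t.
have : `|- (1 / 3) * drift_norm2 t| <= 1 / 3 * (mu i * e ^+ 2) by near: t; exact: G0.
have T0 j b : 0 <= mu j * drift t j b ^+ 2 by rewrite mulr_ge0 ?sqr_ge0// ltW.
have GW : mu i * drift t i a ^+ 2 <= drift_norm2 t.
  rewrite /drift_norm2 (bigD1 i)//= (bigD1 a)//= -addrA lerDl addr_ge0// sumr_ge0//.
  by move=> j _; exact: sumr_ge0.
rewrite mulNr normrN ger0_norm ?mulr_ge0// ?divr_ge0// ?(le_trans (T0 i a))//.
rewrite ler_pM2l ?divr_gt0// => /(le_trans GW).
rewrite ler_pM2l// -(real_normK (num_real (drift t i a))).
by rewrite ler_sqr ?nnegrE ?normr_ge0// ltW.
Unshelve. all: by end_near. Qed.

(** The time derivative of the acceleration, with inverse distances kept as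
    factors so that [jerk_growth] reads off its order. *)
Definition jerk t i a : R := \sum_(j | j != i) mu j *
  ((V t j a - V t i a) * (rdist (X t) i j)^-1 ^+ 3 +
   (X t j a - X t i a) * (3 * (rdist (X t) i j)^-1 ^+ 2 *
     (- ((\sum_b (X t i b - X t j b) * (V t i b - V t j b)) *
         (rdist (X t) i j)^-1 ^+ 3)))).

Lemma is_derive_accel : \forall t \near +oo, forall i a,
  is_derive (t : R) 1 (fun s => accel mu (X s) i a) (jerk t i a).
Proof.
near=> t => i a.
have dXt : forall i a, is_derive t 1 (fun s => X s i a) (V t i a).
  by move {i a}; near: t.
have cf : collision_free (X t).
  by move {i a dXt}; near: t; exact: near_collision_free.
apply: is_derive1_sum => j ji.
have r0 : rdist (X t) i j != 0 by apply: cf; rewrite eq_sym.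
have dr := is_derive_rdist r0 dXt.
pose rho s := (rdist (X s) i j)^-1.
have drho := @is_derive1V R (fun s => rdist (X s) i j) t _ r0 dr.
have d2 := @is_derive1M R rho rho _ _ _ drho drho.
have d3 := @is_derive1M R _ rho _ _ _ d2 drho.
have dXX := is_derive1cM (mu j) (is_derive1B (dXt j a) (dXt i a)).
rewrite (_ : (fun s => _) = (fun s =>
    mu j * (X s j a - X s i a) * (rho s * rho s * rho s))).
  apply: (is_derive_eq (is_derive1M dXX d3)).
  by rewrite /rho; field.
by apply/funext => s; rewrite /rho -exprVn; congr (_ * _); ring.
Unshelve. all: by end_near. Qed.

Lemma jerk_growth i a : growth (- 7%:Z) (fun t => jerk t i a).
Proof.
apply: growth_sum => j ji; apply: growthZ.
have rV : growth (- 2%:Z) (fun t => (rdist (X t) i j)^-1).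
  by apply: invr_rdist_growth; rewrite eq_sym.
have rV2 : growth (- 4%:Z) (fun t => (rdist (X t) i j)^-1 ^+ 2).
  exact: (growthM _ rV rV).
have rV3 : growth (- 6%:Z) (fun t => (rdist (X t) i j)^-1 ^+ 3).
  exact: (growthM _ rV rV2).
have Xg b k l : growth 2 (fun t => X t k b - X t l b) by exact: growthB.
have Vg b k l : growth (- 1%:Z) (fun t => V t k b - V t l b).
  by apply: growthB; exact: velocity_growth.
apply: growthD; first exact: (growthM _ (Vg _ _ _) rV3).
apply: (growthM (q := - 9%:Z) _ (Xg _ _ _)) => //.
apply: (@growthM _ (- 4%:Z) (- 5%:Z)) => //; first exact: growthZ.
apply/growthN/(growthM (p := 1) _ _ rV3) => //.
apply: growth_sum => b _; exact: (growthM _ (Xg _ _ _) (Vg _ _ _)).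
Qed.

(** [barbalat] for the drift itself, which converges by [drift_cvg0]. *)
Lemma defect_cvg0 i a : defect t i a @[t --> +oo] --> 0.
Proof.
pose D' t := 2 / 9 * ((- 2%:Z)%:~R / 3 * cbrt t ^ (- 2%:Z - 3) * X t i a +
    cbrt t ^ (- 2%:Z) * V t i a) +
  (4%:~R / 3 * cbrt t ^ (4%:Z - 3) * accel mu (X t) i a + cbrt t ^ 4 * jerk t i a).
have dD : \forall t \near +oo, is_derive (t : R) 1 (fun s => defect s i a) (D' t).
  near=> t.
  have t0 : 0 < t by near: t; exact: nbhs_pinfty_gt.
  have dXt : is_derive t 1 (fun s => X s i a) (V t i a) by move: (i) (a); near: t.
  have dAt : is_derive t 1 (fun s => accel mu (X s) i a) (jerk t i a).
    by move: (i) (a); near: t; exact: is_derive_accel.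
  exact: (is_derive1D (is_derive1cM (2 / 9)
    (is_derive1M (is_derive_cbrtX (- 2%:Z) t0) dXt))
    (is_derive1M (is_derive_cbrtX 4 t0) dAt)).
have Dg : growth (- 3%:Z) D'.
  apply: growthD; first (apply: growthZ; apply: growthD).
  - apply: (growthM _ _ (X_growth i a)); last exact/growthZ/growth_cbrt.
    by [].
  - by apply: (growthM _ (growth_cbrt _ (- 2%:Z)) (velocity_growth i a)).
  - apply: growthD.
      apply: (growthM _ _ (accel_growth i a)); last exact/growthZ/growth_cbrt.
      by [].
    by apply: (growthM _ (growth_cbrt _ 4) (jerk_growth i a)).
apply: (barbalat _ (drift_cvg0 i a) _ dD Dg).
  near=> t; move: (i) (a); near: t; exact: is_derive_drift.
rewrite -[X in _ --> X](subr0 0); apply: cvgB.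
  apply: (@growth_cvg0 _ (4 - 7%:Z)) => //.
  exact: (growthM _ (growth_cbrt _ 4) (f_growth i a)).
by rewrite -[X in _ --> X](mulr0 (1 / 3)); apply: cvgMl_tmp; exact: drift_cvg0.
Unshelve. all: by end_near. Qed.

End Dynamics.

(** * Tidal estimate *)

Section Tidal.
Variable R : realType.

(** Here u and w are matching coordinates of two vectors of lengths a and b. *)
Lemma kernel_lipschitz (u w a b d rho : R) :
  0 < rho -> rho <= a -> rho <= b -> `|w| <= b -> `|u - w| <= d ->
  `|a - b| <= 2 * d -> `|u / a ^+ 3 - w / b ^+ 3| <= 7 * d / rho ^+ 3.
Proof.
move=> r0 ra rb wb uw ab.
have a0 := lt_le_trans r0 ra; have b0 := lt_le_trans r0 rb.
have Ar : a^-1 <= rho^-1 by rewrite lef_pV2.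
have Br : b^-1 <= rho^-1 by rewrite lef_pV2.
have A0 : 0 <= a^-1 by rewrite invr_ge0 ltW.
have B0 : 0 <= b^-1 by rewrite invr_ge0 ltW.
have d0 : 0 <= d by apply: le_trans uw.
have P0 : 0 <= rho^-1 by rewrite invr_ge0 ltW.
have wB : `|w / b| <= 1.
  by rewrite normrM normfV (ger0_norm (ltW b0)) ler_pdivrMr// mul1r.
have -> : u / a ^+ 3 - w / b ^+ 3 = (u - w) * (a^-1 ^+ 3)
   - (w / b) * ((a - b) * (a^-1 ^+ 3 + a^-1 ^+ 2 * b^-1 + a^-1 * b^-1 ^+ 2)).
  by field; rewrite !gt_eqF.
set p := a^-1 in Ar A0 *; set r := b^-1 in Br B0 *; set P := rho^-1 in Ar Br P0.
have -> : 7 * d / rho ^+ 3 = d * P ^+ 3 + 1 * (2 * d * (P ^+ 3 + P ^+ 3 + P ^+ 3)).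
  by rewrite /P; field; rewrite gt_eqF.
have p3 : p ^+ 3 <= P ^+ 3 by rewrite lerXn2r.
have p2 : p ^+ 2 * r <= P ^+ 3.
  by rewrite (exprSr P) ler_pM ?exprn_ge0// lerXn2r.
have p1 : p * r ^+ 2 <= P ^+ 3.
  by rewrite (exprS P) ler_pM ?exprn_ge0// lerXn2r.
apply: (le_trans (ler_normB _ _)); apply: lerD.
  by rewrite normrM ler_pM// ger0_norm// exprn_ge0.
rewrite normrM ler_pM// normrM ler_pM// ger0_norm ?lerD//.
by rewrite !addr_ge0 ?mulr_ge0 ?exprn_ge0.
Qed.

(** The constant 2 instead of 1 allows a coordinatewise proof from
    a^2 - b^2 = (a - b)(a + b), without the Cauchy-Schwarz inequality. *)
Lemma rdist_lipschitz n (q : 'M[R]_(n, 2)) i l j : 0 < rdist q i j ->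
  `|rdist q i j - rdist q l j| <= 2 * rdist q i l.
Proof.
move=> r0; have l0 := rdist_ge0 q l j; have d0 := rdist_ge0 q i l.
have s0 : 0 < rdist q i j + rdist q l j by rewrite ltr_wpDr.
rewrite -(ler_pM2r s0) -{1}(ger0_norm (ltW s0)) -normrM.
rewrite -subr_sqr !rdist_sqr -sumrB.
apply: (le_trans (ler_norm_sum _ _ _)).
apply: (@le_trans _ _ (\sum_(a < 2) rdist q i l * (rdist q i j + rdist q l j))).
  apply: ler_sum => a _; rewrite subr_sqr normrM.
  rewrite (_ : q i a - q j a - (q l a - q j a) = q i a - q l a); last by ring.
  rewrite ler_pM ?rdist_coord//.
  by rewrite (le_trans (ler_normD _ _))// lerD ?rdist_coord.
by rewrite big_ord_recl big_ord1 -mulrA [leRHS]mulr_natl mulr2n.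
Qed.

Lemma tidal_bound n (q : 'M[R]_(n, 2)) i l j a rho : 0 < rho ->
  rho <= rdist q i j -> rho <= rdist q l j ->
  `|(q j a - q i a) / rdist q i j ^+ 3 - (q j a - q l a) / rdist q l j ^+ 3|
     <= 7 * rdist q i l / rho ^+ 3.
Proof.
move=> r0 ri rl; apply: (kernel_lipschitz r0 ri rl).
- by rewrite distrC rdist_coord.
- by rewrite (_ : _ - _ = q l a - q i a) ?(rdistC q i l) ?rdist_coord//; ring.
- exact/rdist_lipschitz/(lt_le_trans r0).
Qed.

End Tidal.

(** * Reduction of the full system to the relative motion of a subsystem *)

Section Coordinates.
Variable R : realType.

Lemma is_derive_coord m n (x : R -> 'M[R]_(m, n)) (t : R) i a :
  derivable x t 1 -> is_derive t 1 (fun s => x s i a) (x^`()%classic t i a).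
Proof.
move=> dx; have dxi := (derivable_mxP x t 1).1 dx i a.
rewrite derive1E derive_mx// mxE; exact: derivableP.
Qed.

Lemma derive1_coord m n (x : R -> 'M[R]_(m, n)) (t : R) (D : 'M[R]_(m, n)) :
  (forall i a, is_derive t 1 (fun s => x s i a) (D i a)) -> x^`()%classic t = D.
Proof.
move=> dx; rewrite derive1E derive_mx; last first.
  by apply/derivable_mxP => i a; have [] := dx i a.
by apply/matrixP => i a; rewrite mxE; have [_ ->] := dx i a.
Qed.

End Coordinates.

Section Relative.
Variables (R : realType) (N : nat) (mu : 'I_N -> R).
Implicit Types (q : 'M[R]_(N, 2)) (i l : 'I_N) (a : 'I_2).
Hypothesis mu_gt0 : forall i, 0 < mu i.

Let M := \sum_i mu i.

Lemma barycenterE q a : barycenter mu q 0 a = M^-1 * \sum_i mu i * q i a.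
Proof.
by rewrite mxE summxE; congr (_ * _); apply: eq_bigr => i _; rewrite !mxE.
Qed.

Lemma relativeE q i a : relative mu q i a = q i a - barycenter mu q 0 a.
Proof. by rewrite !mxE. Qed.

Lemma relative_diff q i l a :
  relative mu q i a - relative mu q l a = q i a - q l a.
Proof. by rewrite !relativeE; ring. Qed.

Lemma centeredP q : centered mu q <-> forall a, \sum_i mu i * q i a = 0.
Proof.
split=> [/rowP qc a | qc].
  move: (qc a); rewrite summxE [RHS]mxE => qa; rewrite -[RHS]qa.
  by apply: eq_bigr => i _; rewrite !mxE.
apply/rowP => a; rewrite summxE [RHS]mxE -[RHS](qc a).
by apply: eq_bigr => i _; rewrite !mxE.
Qed.

Hypothesis N_gt0 : (0 < N)%N.

Lemma totalmass_gt0 : 0 < M.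
Proof.
rewrite /M (bigD1 (Ordinal N_gt0))//= ltr_wpDr// sumr_ge0// => i _.
exact: ltW.
Qed.

(** Relative positions are averages of differences of positions, which is why
    only differences of external accelerations matter. *)
Lemma relative_mean q i a :
  relative mu q i a = \sum_l mu l / M * (q i a - q l a).
Proof.
rewrite relativeE barycenterE.
under [RHS]eq_bigr do rewrite mulrBr.
rewrite sumrB -mulr_suml -mulr_suml divff ?gt_eqF ?totalmass_gt0// mul1r.
by congr (_ - _); rewrite mulr_sumr; apply: eq_bigr => l _; ring.
Qed.

Lemma relative_centered q : centered mu (relative mu q).
Proof.
apply/centeredP => a.
under eq_bigr do rewrite relativeE mulrBr.
rewrite sumrB -mulr_suml barycenterE mulrA divff ?gt_eqF ?totalmass_gt0//.
by rewrite mul1r subrr.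
Qed.

Lemma is_derive_barycenter (x : R -> 'M[R]_(N, 2)) (D : 'M[R]_(N, 2)) (t : R) a :
  (forall i a, is_derive t 1 (fun s => x s i a) (D i a)) ->
  is_derive t 1 (fun s => barycenter mu (x s) 0 a) (barycenter mu D 0 a).
Proof.
move=> dx; rewrite barycenterE.
rewrite (_ : (fun s => _) = (fun s => M^-1 * \sum_i mu i * x s i a)).
  apply: is_derive1cM; apply: is_derive1_sum => i _; exact: is_derive1cM.
by apply/funext => s; rewrite barycenterE.
Qed.

Lemma is_derive_relative (x : R -> 'M[R]_(N, 2)) (D : 'M[R]_(N, 2)) (t : R) i a :
  (forall i a, is_derive t 1 (fun s => x s i a) (D i a)) ->
  is_derive t 1 (fun s => relative mu (x s) i a) (relative mu D i a).
Proof.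
move=> dx; rewrite relativeE.
rewrite (_ : (fun s => _) = (fun s => x s i a - barycenter mu (x s) 0 a)).
  by apply: is_derive1B => //; exact: is_derive_barycenter.
by apply/funext => s; rewrite relativeE.
Qed.

(** Internal forces do not move the barycenter. *)
Lemma relative_accel q (e : 'M[R]_(N, 2)) i a :
  relative mu (\matrix_(i, a) (accel mu q i a + e i a)) i a =
  accel mu (relative mu q) i a + relative mu e i a.
Proof.
rewrite !relativeE !barycenterE mxE (accel_translate _ _ _ (W := q)); last first.
  by move=> *; exact: relative_diff.
under eq_bigr do rewrite mxE mulrDr.
by rewrite big_split/= sum_mu_accel add0r addrA.
Qed.

End Relative.

Section Reduction.
Variables (R : realType) (n : nat) (m : 'I_n -> R).
Hypothesis m_gt0 : forall i, 0 < m i.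
Variables (k : {set 'I_n}) (t0 : R) (q : R -> 'M[R]_(n, 2)).
Hypothesis k_ge2 : (2 <= #|k|)%N.
Hypothesis q_parabolic : parabolic k m t0 q.

Let mu := submass k m.
Let N_gt0 : (0 < #|k|)%N := ltnW k_ge2.

Lemma submass_gt0 i : 0 < mu i.
Proof. exact: m_gt0. Qed.

Definition relpos t : 'M[R]_(#|k|, 2) := relative mu (subconf k (q t)).
Definition relvel t : 'M[R]_(#|k|, 2) := relative mu (subconf k (q^`()%classic t)).
(** Attraction of the bodies outside k. *)
Definition external t : 'M[R]_(#|k|, 2) := \matrix_(i, a)
  \sum_(j | j \notin k) m j * (q t j a - q t (enum_val i) a) /
     rdist (q t) (enum_val i) j ^+ 3.

Lemma subconfE (p : 'M[R]_(n, 2)) i a : subconf k p i a = p (enum_val i) a.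
Proof. by rewrite mxE. Qed.

Lemma rdist_subconf (p : 'M[R]_(n, 2)) i j :
  rdist (subconf k p) i j = rdist p (enum_val i) (enum_val j).
Proof. by rewrite /rdist /subconf !row_rowsub. Qed.

Lemma rdist_relpos t i j :
  rdist (relpos t) i j = rdist (q t) (enum_val i) (enum_val j).
Proof.
by rewrite -rdist_subconf; apply: rdist_congr => a; exact: relative_diff.
Qed.

Lemma accel_split (p : 'M[R]_(n, 2)) (i : 'I_#|k|) a :
  accel m p (enum_val i) a = accel mu (subconf k p) i a +
  \sum_(j | j \notin k) m j * (p j a - p (enum_val i) a) /
     rdist p (enum_val i) j ^+ 3.
Proof.
rewrite /accel (bigID (mem k))/=; congr (_ + _).
  rewrite (eq_bigl (fun j => (j \in k) && (j != enum_val i))); last first.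
    by move=> j; rewrite andbC.
  rewrite big_enum_val_cond/=; apply: eq_big => j.
    by rewrite (inj_eq enum_val_inj).
  by move=> _; rewrite !subconfE rdist_subconf.
apply: eq_bigl => j; case: (boolP (j \in k)) => jk; rewrite ?andbF ?andbT//.
by apply: contraNneq jk => ->; exact: enum_valP.
Qed.

Lemma near_solution : \forall t \near +oo, t0 < t.
Proof. apply: nbhs_pinfty_gt; exact: num_real. Qed.

Lemma is_derive_q (t : R) : t0 < t -> forall i a,
  is_derive t 1 (fun s => q s i a) (q^`()%classic t i a).
Proof. by move=> /q_parabolic.1[_ _ dq _ _] i a; exact: is_derive_coord. Qed.

Lemma is_derive_relpos (t : R) : t0 < t -> forall i a,
  is_derive t 1 (fun s => relpos s i a) (relvel t i a).
Proof.
move=> /is_derive_q dq i a; apply: is_derive_relative => j b.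
rewrite subconfE (_ : (fun s => _) = fun s => q s (enum_val j) b)//.
by apply/funext => s; rewrite subconfE.
Qed.

Lemma is_derive_relvel (t : R) : t0 < t -> forall i a,
  is_derive t 1 (fun s => relvel s i a)
    (accel mu (relpos t) i a + relative mu (external t) i a).
Proof.
move=> /q_parabolic.1[_ cf _ ddq eq_motion] i a.
rewrite -relative_accel; apply: is_derive_relative => j b.
rewrite (_ : (fun s => _) = fun s => q^`()%classic s (enum_val j) b); last first.
  by apply/funext => s; rewrite subconfE.
rewrite !mxE -accel_split.
have := is_derive_coord (enum_val j) b ddq.
have /rowP/(_ b) := eq_motion (enum_val j).
rewrite (grad_potentialE _ _ _ cf) !mxE => /mulfI -> //.
by rewrite gt_eqF.
Qed.

Lemma energy_relative (t : R) : t0 < t ->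
  energy mu (subconf k \o q) t = total_energy mu relpos relvel t.
Proof.
move=> tt; rewrite /energy /total_energy /kinetic.
have dsub i a : is_derive t 1 (fun s => (subconf k \o q) s i a)
    (subconf k (q^`()%classic t) i a).
  rewrite subconfE (_ : (fun s => _) = fun s => q s (enum_val i) a); last first.
    by apply/funext => s; rewrite subconfE.
  exact: is_derive_q.
rewrite (derive1_coord dsub).
have -> : (barycenter mu \o (subconf k \o q))^`()%classic t =
    barycenter mu (subconf k (q^`()%classic t)).
  apply: derive1_coord => i a; rewrite ord1.
  exact: (@is_derive_barycenter _ _ mu (subconf k \o q) _ _ _ dsub).
congr (_ - _).
  apply: eq_bigr => i _; rewrite enorm_sqr big_ord1 mulr_sumr.
  by apply: eq_bigr => a _; rewrite /relvel relativeE !mxE.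
apply: eq_bigr => i _; apply: eq_bigr => j _.
by rewrite rdist_relpos rdist_subconf.
Qed.

Lemma cbrt_sqr_powR (t : R) : t `^ (2 / 3) = cbrt t ^+ 2.
Proof. by rewrite -[_ ^+ 2]/(cbrt t ^ 2) cbrtXE. Qed.

Lemma parabolic_bounds : exists C1 C2 C3 : R, [/\ 0 < C1, 0 < C2, 0 < C3 &
  \forall t \near +oo,
    (forall i l : 'I_#|k|, i != l -> C1 * cbrt (t : R) ^+ 2 <=
      rdist (q t) (enum_val i) (enum_val l) <= C2 * cbrt t ^+ 2) /\
    (forall (i : 'I_#|k|) j, j \notin k -> C3 * t <= rdist (q t) (enum_val i) j)].
Proof.
have [_ [C1 [C2 [C3 [C10 C20 C30 Hq]]]]] := q_parabolic.
exists C1, C2, C3; split=> //; apply: filterS Hq => t [Hk Hk']; split.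
  move=> i l il; rewrite -cbrt_sqr_powR; apply: Hk; rewrite ?enum_valP//.
  by rewrite (inj_eq enum_val_inj).
by move=> i j jk; apply: Hk' => //; exact: enum_valP.
Qed.

Lemma relpos_growth i a : growth 2 (fun t => relpos t i a).
Proof.
have [C1 [C2 [C3 [_ C20 _ Hq]]]] := parabolic_bounds.
apply: (growth_near (f := fun t => \sum_l mu l / (\sum_i mu i) *
    (q t (enum_val i) a - q t (enum_val l) a))).
  near=> t; rewrite /relpos (relative_mean submass_gt0 N_gt0).
  by apply: eq_bigr => l _; rewrite !subconfE.
apply: growth_sum => l _; apply: growthZ.
exists C2; apply: filterS Hq => t [Hk _].
have [-> |il] := eqVneq i l.
  by rewrite subrr normr0 mulr_ge0 ?(ltW C20)// exprz_ge0// powR_ge0.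
by apply: (le_trans (rdist_coord _ _ _ _)); have /andP[] := Hk i l il.
Unshelve. all: by end_near. Qed.

Lemma relpos_apart : exists2 c, 0 < c & \forall t \near +oo,
  forall i j, i != j -> c * cbrt (t : R) ^+ 2 <= rdist (relpos t) i j.
Proof.
have [C1 [C2 [C3 [C10 _ _ Hq]]]] := parabolic_bounds.
exists C1 => //; apply: filterS Hq => t [Hk _] i l il.
by rewrite rdist_relpos; have /andP[] := Hk i l il.
Qed.

(** t^(2/3) / t^3 = t^(-7/3): separation inside k over the cube of the distance
    to the bodies outside. *)
Lemma external_growth i a :
  growth (- 7%:Z) (fun t => relative mu (external t) i a).
Proof.
have [C1 [C2 [C3 [_ C20 C30 Hq]]]] := parabolic_bounds.
(* differences of external accelerations, so that only tidal terms remain *)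
apply: (growth_near (f := fun t => \sum_l mu l / (\sum_i mu i) *
  \sum_(j | j \notin k) m j *
    ((q t j a - q t (enum_val i) a) / rdist (q t) (enum_val i) j ^+ 3 -
     (q t j a - q t (enum_val l) a) / rdist (q t) (enum_val l) j ^+ 3))).
  near=> t; rewrite (relative_mean submass_gt0 N_gt0).
  apply: eq_bigr => l _; rewrite !mxE -sumrB; congr (_ * _).
  by apply: eq_bigr => j _; rewrite mulrBr !mulrA.
apply: growth_sum => l _; apply: growthZ.
apply: growth_sum => j jk; apply: growthZ.
exists (7 * C2 / C3 ^+ 3); near=> t.
have t_gt0 : 0 < t by near: t; exact: nbhs_pinfty_gt.
have [Hk Hk'] : (forall i l : 'I_#|k|, i != l -> C1 * cbrt (t : R) ^+ 2 <=
      rdist (q t) (enum_val i) (enum_val l) <= C2 * cbrt t ^+ 2) /\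
    (forall (i : 'I_#|k|) j, j \notin k ->
      C3 * t <= rdist (q t) (enum_val i) j) by near: t.
have ril : rdist (q t) (enum_val i) (enum_val l) <= C2 * cbrt t ^+ 2.
  have [->|il] := eqVneq i l; last by have /andP[] := Hk i l il.
  rewrite /rdist subrr -(scale0r 0) enormZ normr0 mul0r.
  by rewrite mulr_ge0 ?(ltW C20)// exprn_ge0// powR_ge0.
apply: le_trans (tidal_bound a (mulr_gt0 C30 t_gt0) (Hk' i j jk)
  (Hk' l j jk)) _.
have s0 := cbrt_gt0 t_gt0.
rewrite -exprnN -[X in C3 * X](cbrtK (ltW t_gt0)).
have -> : 7 * C2 / C3 ^+ 3 / cbrt t ^+ 7 =
    7 * (C2 * cbrt t ^+ 2) / (C3 * cbrt t ^+ 3) ^+ 3.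
  by field; rewrite !gt_eqF.
rewrite ler_pM2r ?ler_pM2l//.
by rewrite invr_gt0 exprn_gt0// mulr_gt0// exprn_gt0.
Unshelve. all: by end_near. Qed.

End Reduction.

(** * Cluster points and approach to the central configurations *)

Section Compactness.
Variable R : realType.

Lemma cvg_sumr (T I : Type) (F : set_system T) (r : seq I) (P : pred I)
    (f : I -> T -> R) (l : I -> R) {FF : Filter F} :
  (forall i, P i -> f i x @[x --> F] --> l i) ->
  \sum_(i <- r | P i) f i x @[x --> F] --> \sum_(i <- r | P i) l i.
Proof. by apply: cvg_big; exact: add_continuous. Qed.

Lemma cvg_exprn (T : Type) (F : set_system T) (f : T -> R) (l : R) n {FF : Filter F} :
  f x @[x --> F] --> l -> f x ^+ n @[x --> F] --> l ^+ n.
Proof.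
move=> fl; elim: n => [|n IH]; first exact: cvg_cst.
rewrite (_ : (fun x => _) = (fun x => f x * f x ^+ n)); last first.
  by apply/funext => x; rewrite exprS.
by rewrite exprS; exact: cvgM.
Qed.

Lemma cvg_sqrt (T : Type) (F : set_system T) (f : T -> R) (l : R) {FF : Filter F} :
  f x @[x --> F] --> l -> Num.sqrt (f x) @[x --> F] --> Num.sqrt l.
Proof. by move=> fl; exact: (cvg_comp _ _ fl (@sqrt_continuous R _)). Qed.

Lemma vec_mx_continuous m n : continuous (@vec_mx R m n).
Proof.
move=> v A [P Pv PA].
pose Q (ij : 'I_m * 'I_n) (w : 'rV[R]_(m * n)) :=
  P ij.1 ij.2 (w ord0 (mxvec_index ij.1 ij.2)).
have Qv ij : nbhs v (Q ij).
  apply: (@coord_continuous R 1 (m * n) ord0 (mxvec_index ij.1 ij.2) v).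
  by have := Pv ij.1 ij.2; rewrite mxE.
have := filter_forall (nbhs_filter v) Qv.
apply: filterS => w wP; apply: PA => i j; rewrite mxE.
exact: (wP (i, j)).
Qed.

(** Compactness of boxes of row vectors, transported by the reshaping map. *)
Lemma box_compact m n (B : R) :
  compact [set q : 'M[R]_(m, n) | forall i j, `|q i j| <= B].
Proof.
rewrite (_ : [set q | _] = [set vec_mx v | v in
    [set v : 'rV[R]_(m * n) | forall l, v ord0 l \in `[- B, B]]]).
  apply: continuous_compact.
    by apply: continuous_subspaceT; exact: vec_mx_continuous.
  apply: (@rV_compact R _ (fun=> `[- B, B]%classic)).
  by move=> _; exact: segment_compact.
apply/seteqP; split=> [q qB|_ [v vB <-] i j].
  exists (mxvec q); last exact: mxvecK.
  move=> l; case/mxvec_indexP: l => i j.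
  by rewrite mxvecE in_itv/= -ler_norml; exact: qB.
by rewrite mxE ler_norml; have := vB (mxvec_index i j); rewrite in_itv.
Qed.

Lemma cluster_closed (T : topologicalType) (F : set_system T) (z : T)
    (phi : T -> R) (C : set R) : cluster F z ->
  phi x @[x --> z] --> phi z -> closed C -> F (phi @^-1` C) -> C (phi z).
Proof.
move=> Fz cphi Ccl FC; apply: contrapT => nC.
have oC : nbhs (phi z) (~` C) by apply: open_nbhs_nbhs; split => //; exact: closed_openC.
have [x [/= Cx nCx]] := Fz _ _ FC (cphi _ oC).
exact: nCx.
Qed.

Lemma cluster_cvg (T : topologicalType) (F : set_system T) (z : T)
    (phi : T -> R) (l : R) {FF : Filter F} : cluster F z ->
  phi x @[x --> z] --> phi z -> phi x @[x --> F] --> l -> phi z = l.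
Proof.
move=> Fz cphi Fl; apply/eqP; rewrite eq_sym -subr_eq0 -normr_le0.
apply/ler_addgt0Pl => e e0; rewrite addr0.
have := @cluster_closed _ F z (fun x => `|l - phi x|) [set x | x <= e] Fz.
apply; last 1 first.
- by move/cvgrPdist_le : Fl; exact.
- by apply: cvg_norm; apply: cvgB => //; exact: cvg_cst.
- exact: closed_le.
Qed.

End Compactness.

Section NormalizedLimits.
Variables (R : realType) (N : nat) (mu : 'I_N -> R).
Hypothesis mu_gt0 : forall i, 0 < mu i.
Hypothesis N_ge2 : (2 <= N)%N.
Implicit Types (q z : 'M[R]_(N, 2)) (i j : 'I_N) (a : 'I_2).

Lemma inertiaE q : inertia mu q = \sum_i mu i * \sum_a q i a ^+ 2.
Proof.
apply: eq_bigr => i _; rewrite enorm_sqr big_ord1.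
by congr (_ * _); apply: eq_bigr => a _; rewrite mxE.
Qed.

Lemma inertiaZ c q : inertia mu (c *: q) = c ^+ 2 * inertia mu q.
Proof.
rewrite !inertiaE mulr_sumr; apply: eq_bigr => i _.
rewrite mulrCA; congr (_ * _); rewrite mulr_sumr; apply: eq_bigr => a _.
by rewrite mxE exprMn.
Qed.

Lemma coord_cvg q i a : (fun p : 'M[R]_(N, 2) => p i a) @ q --> q i a.
Proof. exact: coord_continuous. Qed.

Lemma rdist_cvg q i j : rdist p i j @[p --> q] --> rdist q i j.
Proof.
have E p : rdist p i j = Num.sqrt (\sum_a (p i a - p j a) ^+ 2).
  by rewrite -rdist_sqr sqrtr_sqr ger0_norm// rdist_ge0.
rewrite E (_ : (fun p => _) = (fun p : 'M[R]_(N, 2) =>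
    Num.sqrt (\sum_a (p i a - p j a) ^+ 2))).
  apply: (cvg_sqrt (F := nbhs q)).
  apply: (cvg_sumr (F := nbhs q)) => a _; apply: (cvg_exprn (F := nbhs q)).
  by apply: cvgB; exact: coord_cvg.
by apply/funext => p; exact: E.
Qed.

Lemma accel_cvg q i a : collision_free q ->
  accel mu p i a @[p --> q] --> accel mu q i a.
Proof.
move=> cf; apply: (cvg_sumr (F := nbhs q)) => j ji; apply: cvgM.
  apply: cvgMl_tmp; by apply: cvgB; exact: coord_cvg.
apply: cvgV; first by rewrite expf_neq0// cf// eq_sym.
by apply: (cvg_exprn (F := nbhs q)); exact: rdist_cvg.
Qed.

Lemma inertia_cvg q : inertia mu p @[p --> q] --> inertia mu q.
Proof.
rewrite inertiaE (_ : inertia mu = (fun p : 'M[R]_(N, 2) =>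
    \sum_i mu i * \sum_a p i a ^+ 2)).
  apply: (cvg_sumr (F := nbhs q)) => i _; apply: cvgMl_tmp.
  apply: (cvg_sumr (F := nbhs q)) => a _.
  by apply: (cvg_exprn (F := nbhs q)); exact: coord_cvg.
by apply/funext => p; exact: inertiaE.
Qed.

Lemma inertia_gt0 q : collision_free q -> 0 < inertia mu q.
Proof.
move=> cf; pose i0 := Ordinal (ltnW N_ge2); pose i1 := Ordinal N_ge2.
have T0 i : 0 <= mu i * \sum_a q i a ^+ 2.
  by rewrite mulr_ge0 ?(ltW (mu_gt0 i))// sumr_ge0// => a _; exact: sqr_ge0.
rewrite lt_def inertiaE sumr_ge0 ?andbT//.
apply: contraNneq (cf i0 i1 isT) => /eqP.
rewrite psumr_eq0// => /allP h.
have q0 i a : q i a = 0.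
  have := h i (mem_index_enum i); rewrite /= mulf_eq0 gt_eqF//= psumr_eq0; last first.
    by move=> *; exact: sqr_ge0.
  by move=> /allP/(_ a (mem_index_enum a)); rewrite /= sqrf_eq0 => /eqP.
rewrite -sqrf_eq0 rdist_sqr big1// => a _.
by rewrite !q0 subrr expr0n.
Qed.

(** Agrees with [normalized] up to recentering: [normalized mu q] is
    [unitize (relative mu q)]. *)
Definition unitize q : 'M[R]_(N, 2) := (Num.sqrt (inertia mu q))^-1 *: q.

(** The acceleration has degree -2, so rescaling by c turns the multiplier
    lambda into lambda / c^3. *)
Lemma unitize_ccs z (lambda : R) : centered mu z -> collision_free z -> 0 < lambda ->
  (forall i a, lambda * z i a + accel mu z i a = 0) ->
  normalized_ccs mu (unitize z).
Proof.
move=> zc cf l0 zcc; have I0 := inertia_gt0 cf.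
have [c cE] : exists c, c = (Num.sqrt (inertia mu z))^-1 by eexists.
have c0 : 0 < c by rewrite cE invr_gt0 sqrtr_gt0.
rewrite /unitize -cE.
have cfc : collision_free (c *: z) by exact: collision_freeZ.
have cent : centered mu (c *: z).
  apply/centeredP => a; move/centeredP/(_ a) : zc => za.
  rewrite -[RHS](mulr0 c) -[X in c * X]za mulr_sumr; apply: eq_bigr => i _.
  by rewrite mxE; ring.
split; first split => //; last split => //.
  exists (lambda * c ^- 3); first by rewrite mulr_gt0// invr_gt0 exprn_gt0.
  move=> i; apply/rowP => a; rewrite mxE grad_potentialE// !mxE accelZ//.
  have -> : accel mu z i a = - (lambda * z i a).
    by apply/eqP; rewrite -addr_eq0 addrC zcc.
  by field; rewrite gt_eqF.
by rewrite inertiaZ cE exprVn sqr_sqrtr ?(ltW I0)// mulVf// gt_eqF.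
Qed.

Lemma unitize_cvg z : 0 < inertia mu z ->
  enorm (unitize p - unitize z) @[p --> z] --> 0.
Proof.
move=> I0; rewrite /enorm.
have E0 : Num.sqrt (\sum_(i < N) \sum_(a < 2) (0 : R) ^+ 2) = 0.
  by rewrite big1 ?sqrtr0// => i _; rewrite big1// => a _; rewrite expr0n.
rewrite -[X in _ --> X]E0.
apply: (cvg_sqrt (F := nbhs z)).
apply: (cvg_sumr (F := nbhs z)) => i _; apply: (cvg_sumr (F := nbhs z)) => a _.
apply: (cvg_exprn (F := nbhs z)).
rewrite -(subrr (unitize z i a)).
rewrite (_ : (fun p => _) = (fun p : 'M[R]_(N, 2) =>
    unitize p i a - unitize z i a)); last first.
  by apply/funext => p; rewrite !mxE.
apply: cvgB; last exact: cvg_cst.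
rewrite mxE (_ : (fun p => _) = (fun p : 'M[R]_(N, 2) =>
    (Num.sqrt (inertia mu p))^-1 * p i a)).
  apply: cvgM; last exact: coord_cvg.
  apply: cvgV; first by rewrite gt_eqF// sqrtr_gt0.
  exact: (cvg_sqrt (F := nbhs z) (inertia_cvg (q := z))).
by apply/funext => p; rewrite mxE.
Qed.

Lemma edistance_ge0 (A : set 'M[R]_(N, 2)) q : (0 <= edistance_to A q)%E.
Proof.
by apply: le_ereal_inf_tmp => _ [y _ <-]; rewrite lee_fin; exact: enorm_ge0.
Qed.

(** If the distance exceeded e frequently, a cluster point of Z along those
    times would be a central configuration, and normalization is continuous
    there. *)
Lemma approach_normalized_ccs (T : Type) (F : set_system T)
    (Z : T -> 'M[R]_(N, 2)) (lambda B c : R) : ProperFilter F -> 0 < lambda -> 0 < c ->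
  (\forall t \near F, centered mu (Z t)) ->
  (\forall t \near F, forall i a, `|Z t i a| <= B) ->
  (\forall t \near F, forall i j, i != j -> c <= rdist (Z t) i j) ->
  (forall i a, lambda * Z t i a + accel mu (Z t) i a @[t --> F] --> 0) ->
  edistance_to (normalized_ccs mu) (unitize (Z t)) @[t --> F] --> 0%:E.
Proof.
move=> FF l0 c0 Zc ZB Zr Zcc.
have key e : 0 < e ->
    \forall t \near F, (edistance_to (normalized_ccs mu) (unitize (Z t)) <= e%:E)%E.
  move=> e0; apply: contrapT => nF.
  pose D := [set t | ~ (edistance_to (normalized_ccs mu) (unitize (Z t)) <= e%:E)%E].
  have GP : ProperFilter (within D F).
    apply: Build_ProperFilter.
    move=> FD; apply: nF; apply: (filterS (F := F) _ FD) => t Dt; exact: contrapT.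
  have near_within (P : set T) : F P -> within D F P.
    by move=> FP; apply: (filterS (F := F) _ FP) => t Pt _.
  have [z [_ Gz]] := @box_compact R N 2 B _ (fmap_proper_filter Z GP)
    (near_within _ ZB).
  have zc : centered mu z.
    apply/centeredP => a.
    apply: (cluster_closed (phi := fun q => \sum_i mu i * q i a) (C := [set 0]) Gz).
    - by apply: (cvg_sumr (F := nbhs z)) => i _; apply: cvgMl_tmp; exact: coord_cvg.
    - exact: closed_eq.
    - by apply: near_within; apply: filterS Zc => t /centeredP /=.
  have zr i j : i != j -> c <= rdist z i j.
    move=> ij.
    apply: (cluster_closed (phi := fun q => rdist q i j) (C := [set x | c <= x]) Gz).
    - exact: rdist_cvg.
    - exact: closed_ge.
    - by apply: near_within; apply: filterS Zr => t /(_ i j ij).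
  have zcf : collision_free z by move=> i j /zr r; rewrite gt_eqF// (lt_le_trans c0).
  have zcc i a : lambda * z i a + accel mu z i a = 0.
    pose phi (q : 'M[R]_(N, 2)) := lambda * q i a + accel mu q i a.
    have cz : phi q @[q --> z] --> phi z.
      by apply: (cvgD (F := nbhs z));
        [apply: (cvgMl_tmp (F := nbhs z)); exact: coord_cvg | exact: accel_cvg].
    apply: (cluster_cvg (phi := phi) Gz cz).
    by move=> A /(Zcc i a) FA; exact: (near_within _ FA).
  have zN := unitize_ccs zc zcf l0 zcc.
  have := unitize_cvg (inertia_gt0 zcf).
  move=> /cvgr0Pnorm_le/(_ _ e0) ze.
  have GD : (Z @ within D F) [set q |
      ~ (edistance_to (normalized_ccs mu) (unitize q) <= e%:E)%E].
    by apply: (filterS _ (withinT D FF)) => t.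
  have [q [/= nq qe]] := Gz _ _ GD ze.
  apply: nq; apply: (@le_trans _ _ (enorm (unitize q - unitize z))%:E).
    by apply: ereal_inf_lbound; exists (unitize z).
  by rewrite lee_fin (le_trans (ler_norm _)).
apply/fine_cvgP; split.
  apply: filterS (key 1 ltr01) => t h.
  by rewrite ge0_fin_numE ?edistance_ge0// (le_lt_trans h)// ltry.
apply/cvgr0Pnorm_le => e e0; apply: filterS (key e e0) => t h /=.
rewrite ger0_norm ?fine_ge0 ?edistance_ge0// -lee_fin fineK//.
by rewrite ge0_fin_numE ?edistance_ge0// (le_lt_trans h)// ltry.
Qed.

End NormalizedLimits.

Lemma unitizeZ (R : realType) N (mu : 'I_N -> R) (c : R) (q : 'M[R]_(N, 2)) :
  0 < c -> unitize mu (c *: q) = unitize mu q.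
Proof.
move=> c0; rewrite /unitize inertiaZ sqrtrM ?sqr_ge0// sqrtr_sqr (ger0_norm (ltW c0)).
by rewrite scalerA invfM mulrAC mulVf ?mul1r// gt_eqF.
Qed.

Theorem proposition1p6 (R : realType) (n : nat) (m : 'I_n -> R)
    (m_gt0 : forall i : 'I_n, 0 < m i)
    (k : {set 'I_n}) (k_ge2 : (2 <= #|k|)%N)
    (t0 : R) (q : R -> 'M[R]_(n, 2)) (q_parabolic : parabolic k m t0 q) :
  (fun t : R => `|energy (submass k m) (subconf k \o q) t|)
    =O_ (pinfty_nbhs R) (fun t : R => t `^ (- (5 / 3))) /\
  edistance_to (normalized_ccs (submass k m))
    (normalized (submass k m) (subconf k (q t))) @[t --> pinfty_nbhs R]
    --> 0%:E.
Proof.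
pose X := relpos m k q; pose V := relvel m k q.
pose F t := relative (submass k m) (external m k q t).
have mu_gt0 := submass_gt0 m_gt0 (k := k).
have dX : \forall t \near +oo, forall i a,
    is_derive (t : R) 1 (fun s => X s i a) (V t i a).
  near=> t; apply: (is_derive_relpos q_parabolic).
  by near: t; exact: near_solution.
have dV : \forall t \near +oo, forall i a,
    is_derive (t : R) 1 (fun s => V s i a) (accel (submass k m) (X t) i a + F t i a).
  near=> t; apply: (is_derive_relvel m_gt0 q_parabolic).
  by near: t; exact: near_solution.
have Xg := relpos_growth m_gt0 k_ge2 q_parabolic.
have Fg := external_growth m_gt0 k_ge2 q_parabolic.
have [c c0 Xc] := relpos_apart q_parabolic.
split.
  apply/eqO_exP.
  have [C C0 hC] := growth_ge0 (energy_growth mu_gt0 dX dV Xg Fg c0 Xc).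
  exists C => //; near=> t.
  have -> : energy (submass k m) (subconf k \o q) t = total_energy (submass k m) X V t.
    apply: (energy_relative q_parabolic).
    by near: t; exact: near_solution.
  rewrite normr_id (ger0_norm (powR_ge0 _ _)).
  have -> : t `^ (- (5 / 3)) = cbrt t ^ (- 5%:Z).
    by rewrite cbrtXE; congr (_ `^ _); rewrite mulNr.
  by near: t.
pose Z t := (cbrt t)^-1 ^+ 2 *: X t.
have s0 : \forall t \near +oo, 0 < (cbrt (t : R))^-1 ^+ 2.
  near=> t; rewrite exprn_gt0// invr_gt0.
  by near: t; exact: near_cbrt_gt0.
have ZX : \forall t \near +oo,
    edistance_to (normalized_ccs (submass k m)) (unitize (submass k m) (Z t)) =
    edistance_to (normalized_ccs (submass k m))
      (normalized (submass k m) (subconf k (q t))).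
  near=> t; rewrite unitizeZ//.
  by near: t.
apply: cvg_trans; first exact: near_eq_cvg ZX.
have l0 : 0 < 2 / 9 :> R by rewrite divr_gt0.
have Zc : \forall t \near +oo, centered (submass k m) (Z t).
  near=> t; apply/centeredP => a.
  have /centeredP/(_ a) Xa := relative_centered mu_gt0 (ltnW k_ge2) (subconf k (q t)).
  rewrite -[RHS](mulr0 ((cbrt t)^-1 ^+ 2)) -[X in _ = _ * X]Xa mulr_sumr.
  by apply: eq_bigr => i _; rewrite mxE mulrCA.
have Zr : \forall t \near +oo, forall i j, i != j -> c <= rdist (Z t) i j.
  near=> t => i j ij.
  have st : 0 < cbrt t by move {i j ij}; near: t; exact: near_cbrt_gt0.
  rewrite rdistZ ?exprn_ge0 ?invr_ge0 ?(ltW st)// exprVn mulrC ler_pdivlMr ?exprn_gt0//.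
  by move: i j ij {st}; near: t.
have [B ZB] : exists B, \forall t \near +oo, forall i a, `|Z t i a| <= B.
  have Zg i a : growth 0 (fun t => Z t i a).
    apply: (growth_near (f := fun t => cbrt t ^ (- 2%:Z) * X t i a)).
      by near=> t; rewrite [RHS]mxE exprVn -exprnN.
    exact: (growthM _ (growth_cbrt _ (- 2%:Z)) (Xg i a)).
  have Zb ia : exists B : R, \forall t \near +oo, `|Z t ia.1 ia.2| <= B.
    have [C hC] := Zg ia.1 ia.2; exists C; near=> t.
    by rewrite -[C]mulr1 -(expr0z (cbrt t)); near: t.
  have [B hB] := choice Zb.
  exists (\sum_ia `|B ia|).
  have : \forall t \near +oo, forall ia, `|Z t ia.1 ia.2| <= B ia.
    exact: filter_forall.
  apply: filterS => t ht i a; apply: (le_trans (ht (i, a))).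
  by rewrite (bigD1 (i, a))//= ler_wpDr ?ler_norm// sumr_ge0.
apply: (approach_normalized_ccs mu_gt0 k_ge2 _ l0 c0 Zc ZB Zr) => i a.
have := defect_cvg0 mu_gt0 dX dV Xg Fg c0 Xc i a.
apply: cvg_trans; apply: near_eq_cvg; near=> t.
have st : 0 < cbrt t by near: t; exact: near_cbrt_gt0.
have ZE : Z t i a = cbrt t ^ (- 2%:Z) * X t i a by rewrite [LHS]mxE exprVn exprnN.
rewrite /defect accelZ ?exprn_gt0 ?invr_gt0// ZE.
by rewrite -exprM exprVn invrK.
Unshelve. all: by end_near. Qed.
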